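(* Let $\Omega,\Omega_1,\Omega_2,\ldots$ be bounded open subsets of $\mathbb{R}^d$ and suppose that $\Omega_n\uparrow\Omega$ as $n\to\infty$. Write $\mathscr{H}=\mathscr{H}(\Omega)$, $\mathcal{B}_0=\mathcal{B}_0(\Omega)$ (the weak-Dirichlet Stokes operator in $\mathscr{H}$) and $I$ for the identity operator on $\mathscr{H}$. For each $n\in\mathbb{N}$ write $\mathscr{H}_n=\mathscr{H}(\Omega_n)$, let $\mathbb{P}_n$ be the orthogonal (Leray) projection from $L^2(\Omega_n,\mathbb{R}^d)$ onto $\mathscr{H}_n$, let $I_n$ be the identity operator on $\mathscr{H}_n$, and let $\mathcal{B}_0^{(n)}=\mathcal{B}_0(\Omega_n)$ be the weak-Dirichlet Stokes operator in $\mathscr{H}_n$. For $f\in\mathscr{H}$ put $$u_n:=\bigl(I_n+\mathcal{B}_0^{(n)}\bigr)^{-1}\mathbb{P}_n\bigl(f|_{\Omega_n}\bigr)\in\mathscr{H}_n ,$$ and let $\tilde u_n$ denote the extension of $u_n$ by $0$ to $\mathbb{R}^d$. Then for every $f\in\mathscr{H}$, $$\lim_{n\to\infty}\tilde u_n|_{\Omega}=(I+\mathcal{B}_0)^{-1}f\qquad\text{in } L^2(\Omega,\mathbb{R}^d).$$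
   Context: All function spaces are real. For an open set $\Omega\subset\mathbb{R}^d$, the space $L^2(\Omega,\mathbb{R}^d)$ carries the scalar product $\langle u,v\rangle=\int_\Omega u\cdot v$. Gradients and the space $\mathscr{H}(\Omega)$: let $\mathscr{G}(\Omega)=\{\nabla\pi:\ \pi\in L^2_{\rm loc}(\Omega),\ \nabla\pi\in L^2(\Omega,\mathbb{R}^d)\}$ (gradient in the sense of distributions). This is a closed subspace of $L^2(\Omega,\mathbb{R}^d)$. Let $\mathscr{H}(\Omega)$ be its orthogonal complement in $L^2(\Omega,\mathbb{R}^d)$. The orthogonal projection from $L^2(\Omega,\mathbb{R}^d)$ onto $\mathscr{H}(\Omega)$ is called the Leray projection. Form domain: let $\mathscr{D}(\Omega)=\{u\in C_c^\infty(\Omega,\mathbb{R}^d):\ \operatorname{div}u=0 \text{ in }\Omega\}$, and let $\mathscr{V}(\Omega)$ be the closure of $\mathscr{D}(\Omega)$ in $H^1_0(\Omega,\mathbb{R}^d)$ for the $H^1$-norm. One has $\mathscr{D}(\Omega)\subset\mathscr{V}(\Omega)\subset\mathscr{H}(\Omega)$, and $\mathscr{D}(\Omega)$ is dense in $\mathscr{H}(\Omega)$ for the $L^2$-norm. Weak-Dirichlet Stokes operator: $\mathcal{B}_0(\Omega)$ is the self-adjoint operator in the Hilbert space $\mathscr{H}(\Omega)$ associated with the closed symmetric positive densely defined form $\mathfrak{a}(u,v)=\sum_{j=1}^d\int_\Omega\partial_j u\cdot\partial_j v$, $u,v\in\mathscr{V}(\Omega)$. That is, $u\in D(\mathcal{B}_0(\Omega))$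 and $\mathcal{B}_0(\Omega)u=w$ if and only if $u\in\mathscr{V}(\Omega)$, $w\in\mathscr{H}(\Omega)$ and $\mathfrak{a}(u,v)=\langle w,v\rangle$ for all $v\in\mathscr{V}(\Omega)$. Convergence of domains: $\Omega_n\uparrow\Omega$ as $n\to\infty$ means that $\Omega_n\subset\Omega_{n+1}\subset\Omega$ for all $n\in\mathbb{N}$ and that for each compact $K\subset\Omega$ there exists $n\in\mathbb{N}$ with $K\subset\Omega_n$. *)

(* Defs.v *)
From HB Require Import structures.
From mathcomp Require Import all_boot all_order all_algebra.
From mathcomp Require Import all_classical all_reals all_analysis.

Set Implicit Arguments.
Unset Strict Implicit.
Unset Printing Implicit Defensive.

Import Order.TTheory GRing.Theory Num.Theory.
Import numFieldNormedType.Exports.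

Local Open Scope classical_set_scope.
Local Open Scope ring_scope.

Definition measure_rV_display : measure_display -> measure_display.
Proof. exact. Qed.

(* The product sigma-algebra on R^d, generated by the coordinate maps as in
   the library's instance on n.-tuple T. Since R is second countable, it is
   also the Borel sigma-algebra of 'rV[R]_d. *)
Section measurable_rV.
Context {R : realType} (d : nat).

Let coors : 'I_d -> 'rV[R]_d -> R := fun i x => x ord0 i.

Let rV_set0 : g_sigma_preimage coors set0.
Proof. exact: sigma_algebra0. Qed.

Let rV_setC A : g_sigma_preimage coors A -> g_sigma_preimage coors (~` A).
Proof. exact: sigma_algebraC. Qed.

Let rV_bigcup (F : _^nat) : (forall i, g_sigma_preimage coors (F i)) ->
  g_sigma_preimage coors (\bigcup_i (F i)).
Proof. exact: sigma_algebra_bigcup. Qed.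

HB.instance Definition _ := @isMeasurable.Build
  (measure_rV_display default_measure_display)
  'rV[R]_d (g_sigma_preimage coors) rV_set0 rV_setC rV_bigcup.

End measurable_rV.

Section lebesgue_rV.
Context {R : realType}.

Definition cons_rV d (p : measurableTypeR R * 'rV[R]_d) : 'rV[R]_d.+1 :=
  \row_i (if unlift ord0 i is Some j then p.2 ord0 j else p.1).

Lemma measurable_rV_coord d (i : 'I_d) :
  measurable_fun [set: 'rV[R]_d] (fun x => x ord0 i).
Proof.
move=> _ Y mY; rewrite setTI; apply: sub_sigma_algebra => /=.
rewrite -bigcup_seq/=; exists i => /=; first by rewrite mem_index_enum.
by exists Y => //; rewrite setTI.
Qed.

Lemma measurable_fun_rVP d d' (T : measurableType d) (f : T -> 'rV[R]_d') :
  (forall i, measurable_fun setT (fun t => f t ord0 i)) ->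
  measurable_fun setT f.
Proof.
move=> mf; suff : g_sigma_preimage (fun i t => f t ord0 i) `<=` measurable.
  rewrite (@g_sigma_preimage_comp _ R d' _ (fun i (x : 'rV[R]_d') => x ord0 i) T f).
  by move=> prefS _ A mA; apply: prefS; exists A.
apply: smallest_sub; first exact: sigma_algebra_measurable.
rewrite -bigcup_seq/=; apply: bigcup_sub => i _ _ [B mB <-].
exact: mf.
Qed.

Lemma measurable_cons_rV d : measurable_fun setT (@cons_rV d).
Proof.
apply: measurable_fun_rVP => i; under eq_fun do rewrite mxE.
case: unliftP => [j _|_]; last exact: measurable_fst.
exact: (measurableT_comp (measurable_rV_coord j) measurable_snd).
Qed.

Fixpoint lebesgue_rV d : {measure set 'rV[R]_d -> \bar R} :=
  match d with
  | 0 => dirac (0 : 'rV[R]_0)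
  | d'.+1 => measure_function_pushforward__canonical__measure_function_Measure
     (lebesgue_measure \x^ lebesgue_rV d')%E (@measurable_cons_rV d')
  end.

(* This characterizes Lebesgue measure. *)
Lemma lebesgue_rV_box d (a b : 'I_d -> R) : (forall i, a i <= b i) ->
  lebesgue_rV d [set x : 'rV[R]_d | forall i, x ord0 i \in `]a i, b i]] =
  (\prod_(i < d) (b i - a i))%:E.
Proof.
elim: d a b => [|d IHd] a b ab /=.
  by rewrite big_ord0 diracE mem_set// => -[].
have mbox : measurable
    [set x : 'rV[R]_d | forall i, x ord0 i \in `]a (lift ord0 i), b (lift ord0 i)]].
  rewrite [X in measurable X](_ : _ = \bigcap_(i in [set: 'I_d])
    ((fun x : 'rV[R]_d => x ord0 i) @^-1` `]a (lift ord0 i), b (lift ord0 i)])).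
    apply: fin_bigcap_measurable => // i _.
    by rewrite -[X in measurable X]setTI; exact: measurable_rV_coord.
  by apply/seteqP; split => [x xab i _|x xab i]; [exact: xab|exact: (xab i)].
rewrite /pushforward [X in (_ \x^ _)%E X](_ : _ = `]a ord0, b ord0] `*`
  [set x : 'rV[R]_d | forall i, x ord0 i \in `]a (lift ord0 i), b (lift ord0 i)]]).
  rewrite product_measure2E// IHd// big_ord_recl EFinM; congr (_ * _)%E.
  rewrite [LHS](lebesgue_measure_itv `]a ord0, b ord0])/= lte_fin.
  by have := ab ord0; rewrite le_eqVlt => /predU1P[->|->]; rewrite ?ltxx ?subrr.
apply/seteqP; split => [[t x]/= H|[t x]/= [ht hx] i].
  split; first by have := H ord0; rewrite mxE unlift_none.
  by move=> i; have := H (lift ord0 i); rewrite mxE liftK.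
by rewrite mxE; case: unliftP => [j ->|->].
Qed.

End lebesgue_rV.

(* In everything below, a function on an open set Omega is represented by a
   total function on R^d whose values outside Omega are irrelevant, and an
   element of L^2(Omega) by any member of its class modulo equality almost
   everywhere on Omega. In particular restriction to a smaller open set is
   invisible. Objects of L^2(Omega) that are determined only up to such equality
   (leray, weak_partial, stokes_resolvent) are selected by [get]. *)
Section function_spaces.
Context {R : realType} {d : nat}.
Local Notation mu := (@lebesgue_rV R d).
Local Notation scalar_field := ('rV[R]_d -> R).
Local Notation vector_field := ('rV[R]_d -> 'rV[R]_d).

Implicit Types (Omega D : set 'rV[R]_d) (p g phi : scalar_field).
Implicit Types (u v w f G : vector_field) (i j : 'I_d).

Definition coord i u : scalar_field := fun x => u x ord0 i.

Definition partial j phi : scalar_field := 'D_(delta_mx ord0 j) phi.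

Definition iter_partial (s : seq 'I_d) phi : scalar_field :=
  foldr partial phi s.

Definition smooth phi := forall s : seq 'I_d,
  continuous (iter_partial s phi) /\
  forall j x, derivable (iter_partial s phi) x (delta_mx ord0 j).

Definition supp phi : set 'rV[R]_d := closure [set x | phi x != 0].

(* Elements of C_c^infty(Omega) are extended by 0 to R^d. *)
Definition test_fun Omega : set scalar_field :=
  [set phi | [/\ smooth phi, compact (supp phi) & supp phi `<=` Omega]].

Definition test_field Omega : set vector_field :=
  [set u | forall i, test_fun Omega (coord i u)].

Definition L2 D : set scalar_field :=
  [set p : scalar_field | measurable_fun D p /\ mu.-integrable D (fun x => (p x ^+ 2)%:E)].

Definition L2_field D : set vector_field :=
  [set u | forall i, L2 D (coord i u)].

Definition L2_loc Omega : set scalar_field :=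
  [set p : scalar_field | forall K, compact K -> K `<=` Omega -> L2 K p].

Definition L2_dot D u v : R :=
  \int[mu]_(x in D) (\sum_(i < d) u x ord0 i * v x ord0 i).

Definition ext0 D u : vector_field := patch (fun=> 0) D u.

Definition L2_norm D u : R := Num.sqrt (L2_dot D u u).

Definition L2_cvg D (u_ : nat -> vector_field) u :=
  [/\ forall n, L2_field D (u_ n), L2_field D u &
      L2_norm D (u_ n \- u) @[n --> \oo] --> (0 : R)].

(* d_j p = g in the sense of distributions on Omega *)
Definition is_weak_partial Omega j p g := forall phi, test_fun Omega phi ->
  \int[mu]_(x in Omega) (p x * partial j phi x) =
  - \int[mu]_(x in Omega) (g x * phi x).

Definition gradients Omega : set vector_field :=
  [set G | L2_field Omega G /\ exists p, L2_loc Omega p /\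
    forall j, is_weak_partial Omega j p (coord j G)].

Definition Hspace Omega : set vector_field :=
  [set u | L2_field Omega u /\
    forall G, gradients Omega G -> L2_dot Omega u G = 0].

(* orthogonal projection onto Hspace Omega, for f in L^2(Omega, R^d) *)
Definition leray Omega f : vector_field :=
  get [set g | Hspace Omega g /\
    forall h, Hspace Omega h -> L2_dot Omega (f \- g) h = 0].

(* meaningful when p has a weak partial derivative in L^2(Omega) *)
Definition weak_partial Omega j p : scalar_field :=
  get [set g | L2 Omega g /\ is_weak_partial Omega j p g].

Definition weak_partial_field Omega j u : vector_field :=
  fun x => \row_i weak_partial Omega j (coord i u) x.

Definition H1 Omega : set vector_field :=
  [set u | L2_field Omega u /\
    forall i j, exists g, L2 Omega g /\ is_weak_partial Omega j (coord i u) g].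

Definition stokes_form Omega u v : R := \sum_(j < d)
  L2_dot Omega (weak_partial_field Omega j u) (weak_partial_field Omega j v).

Definition H1_norm Omega u : R :=
  Num.sqrt (L2_dot Omega u u + stokes_form Omega u u).

Definition H1_closure Omega (S : set vector_field) : set vector_field :=
  [set u | H1 Omega u /\
    forall e : R, 0 < e -> exists2 v, S v & H1_norm Omega (u \- v) < e].

Definition H10 Omega : set vector_field := H1_closure Omega (test_field Omega).

Definition Dspace Omega : set vector_field :=
  [set u | test_field Omega u /\
    forall x, Omega x -> \sum_(i < d) partial i (coord i u) x = 0].

Definition Vspace Omega : set vector_field :=
  H10 Omega `&` H1_closure Omega (Dspace Omega).

(* graph of the weak-Dirichlet Stokes operator B_0(Omega) *)
Definition stokes Omega u w :=
  [/\ Vspace Omega u, Hspace Omega w &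
      forall v, Vspace Omega v -> stokes_form Omega u v = L2_dot Omega w v].

(* (I + B_0(Omega))^-1 f *)
Definition stokes_resolvent Omega f : vector_field :=
  get [set u | exists w, stokes Omega u w /\
    {ae mu, forall x, Omega x -> u x + w x = f x}].

Definition domain_cvg (Omega_ : nat -> set 'rV[R]_d) Omega :=
  (forall n, Omega_ n `<=` Omega_ n.+1 /\ Omega_ n.+1 `<=` Omega) /\
  forall K, compact K -> K `<=` Omega -> exists n, K `<=` Omega_ n.

End function_spaces.

(* Main.v *)
Require Import Defs.
From mathcomp Require Import all_boot all_order all_algebra.
From mathcomp Require Import all_classical all_reals all_analysis.
From mathcomp Require Import measurable_realfun ring lra.
Import Order.TTheory GRing.Theory Num.Theory.
Import numFieldNormedType.Exports.

(* Extended by zero, the solution [u_n] on [Omega_ n] is the orthogonal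
   projection, for the H^1 inner product [<u, v> + a(u, v)], of the solution
   [u] on [Omega] onto the extended form domain of [Omega_ n]: both represent
   the functional [v |-> <f, v>] there, because divergence-free test fields are
   orthogonal to gradients and so do not see the Leray projection. Hence
   [u_n] is at least as close to [u] as any divergence-free test field [v] of
   [Omega_ n]. Such fields of [Omega] are dense in the form domain, and each
   of them has compact support, so that it is a field of [Omega_ n] for all
   large [n].
   Since the objects in the statement are picked by [get], one also has to
   show that they exist (Riesz representation in complete subspaces) and that
   weak derivatives are unique almost everywhere (fundamental lemma of the
   calculus of variations, tested against tensor products of smooth bumps). *)

Set Implicit Arguments.
Unset Strict Implicit.
Unset Printing Implicit Defensive.

Local Open Scope classical_set_scope.
Local Open Scope ring_scope.

(* [coord] would otherwise denote coordinates in a [vectType]. *)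
Local Notation coord := Defs.coord.

(** * Semi-inner products *)

Section semi_inner_product.
Context {R : realType} {X : lmodType R}.
Implicit Types (L M : set X) (B : X -> X -> R).

Definition subspace M :=
  [/\ M 0, forall x y, M x -> M y -> M (x + y) & forall a x, M x -> M (a *: x)].

Definition semi_inner L B := [/\ subspace L,
  (forall x y, B x y = B y x),
  (forall x y z, L x -> L y -> L z -> B (x + y) z = B x z + B y z),
  (forall a x z, L x -> L z -> B (a *: x) z = a * B x z) &
  (forall x, L x -> 0 <= B x x)].

Definition seminorm B x := Num.sqrt (B x x).

Lemma subspaceN M x : subspace M -> M x -> M (- x).
Proof. by move=> [_ _ MZ] Mx; rewrite -scaleN1r; exact: MZ. Qed.

Lemma subspaceB M x y : subspace M -> M x -> M y -> M (x - y).
Proof. by move=> sM Mx My; case: (sM) => _ MD _; apply: MD => //; exact: subspaceN. Qed.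

Variables (L : set X) (B : X -> X -> R).
Hypothesis siB : semi_inner L B.

Let sL : subspace L. Proof. by case: siB. Qed.
Let LD x y : L x -> L y -> L (x + y). Proof. by case: sL => _ + _; exact. Qed.
Let LZ a x : L x -> L (a *: x). Proof. by case: sL => _ _; exact. Qed.
Let LB x y : L x -> L y -> L (x - y). Proof. exact: subspaceB. Qed.

Lemma siC x y : B x y = B y x.
Proof. by case: siB => _ + _ _ _; exact. Qed.

Lemma siDl x y z : L x -> L y -> L z -> B (x + y) z = B x z + B y z.
Proof. by case: siB => _ _ + _ _; exact. Qed.

Lemma siZl a x z : L x -> L z -> B (a *: x) z = a * B x z.
Proof. by case: siB => _ _ _ + _; exact. Qed.

Lemma si_ge0 x : L x -> 0 <= B x x.
Proof. by case: siB => _ _ _ _; exact. Qed.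

Lemma siDr x y z : L x -> L y -> L z -> B z (x + y) = B z x + B z y.
Proof. by move=> *; rewrite siC siDl// !(siC z). Qed.

Lemma siZr a x z : L x -> L z -> B z (a *: x) = a * B z x.
Proof. by move=> *; rewrite siC siZl// (siC z). Qed.

Lemma siNl x z : L x -> L z -> B (- x) z = - B x z.
Proof. by move=> *; rewrite -scaleN1r siZl// mulN1r. Qed.

Lemma siNr x z : L x -> L z -> B z (- x) = - B z x.
Proof. by move=> *; rewrite -scaleN1r siZr// mulN1r. Qed.

Lemma siBl x y z : L x -> L y -> L z -> B (x - y) z = B x z - B y z.
Proof. by move=> *; rewrite siDl ?siNl//; exact: subspaceN. Qed.

Lemma siBr x y z : L x -> L y -> L z -> B z (x - y) = B z x - B z y.
Proof. by move=> *; rewrite siC siBl// !(siC z). Qed.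

Lemma si_sqD x y : L x -> L y -> B (x + y) (x + y) = B x x + 2 * B x y + B y y.
Proof. by move=> Lx Ly; have Lxy := LD Lx Ly; rewrite siDl// !siDr// (siC y x); ring. Qed.

Lemma si_sqB x y : L x -> L y -> B (x - y) (x - y) = B x x - 2 * B x y + B y y.
Proof. by move=> Lx Ly; have Lxy := LB Lx Ly; rewrite siBl// !siBr// (siC y x); ring. Qed.

Lemma quadratic_ge0_eq0 (b s : R) : 0 <= b ->
  (forall t, 0 <= t ^+ 2 * b + 2 * t * s) -> s = 0.
Proof.
move=> b0 H; apply/eqP; apply/negPn/negP => s0.
have b1 : 0 < b + 1 by lra.
have := H (- s / (b + 1)).
have -> : (- s / (b + 1)) ^+ 2 * b + 2 * (- s / (b + 1)) * s =
   - (s ^+ 2 * (b + 2) / (b + 1) ^+ 2) by field; lra.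
rewrite leNgt oppr_lt0 => /negP; apply.
by rewrite divr_gt0// ?exprn_gt0// mulr_gt0//; [rewrite exprn_even_gt0|lra].
Qed.

Lemma CauchySchwarz_sq x y : L x -> L y -> B x y ^+ 2 <= B x x * B y y.
Proof.
move=> Lx Ly.
have H t : 0 <= t ^+ 2 * B x x + 2 * t * B x y + B y y.
  have Ltx := LZ t Lx.
  have := si_ge0 (LD Ltx Ly); rewrite si_sqD// !siZl// siZr//.
  by move=> H; apply: le_trans H _; rewrite le_eqVlt; apply/orP; left; apply/eqP; ring.
have := si_ge0 Lx; rewrite le_eqVlt => /predU1P[/esym Bx0|Bx0].
  rewrite Bx0 mul0r; have By := si_ge0 Ly.
  have [->|Bxy0] := eqVneq (B x y) 0; first by rewrite expr0n.
  have := H (- (B y y + 1) / (2 * B x y)); rewrite Bx0 mulr0 add0r.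
  have -> : 2 * (- (B y y + 1) / (2 * B x y)) * B x y = - (B y y + 1) by field.
  by lra.
have := H (- B x y / B x x).
have -> : (- B x y / B x x) ^+ 2 * B x x + 2 * (- B x y / B x x) * B x y + B y y =
  (B x x * B y y - B x y ^+ 2) / B x x by field; lra.
by rewrite pmulr_lge0 ?invr_gt0// subr_ge0.
Qed.

Lemma seminorm_ge0 x : 0 <= seminorm B x. Proof. exact: sqrtr_ge0. Qed.

Lemma sqr_seminorm x : L x -> seminorm B x ^+ 2 = B x x.
Proof. by move=> Lx; rewrite sqr_sqrtr// si_ge0. Qed.

Lemma CauchySchwarz x y : L x -> L y -> `|B x y| <= seminorm B x * seminorm B y.
Proof.
move=> Lx Ly; rewrite -ler_sqr ?nnegrE ?mulr_ge0 ?seminorm_ge0//.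
by rewrite exprMn !sqr_seminorm// real_normK ?num_real// CauchySchwarz_sq.
Qed.

Lemma ler_seminormD x y : L x -> L y ->
  seminorm B (x + y) <= seminorm B x + seminorm B y.
Proof.
move=> Lx Ly; rewrite -ler_sqr ?nnegrE ?addr_ge0 ?seminorm_ge0//.
rewrite sqrrD !sqr_seminorm//; last exact: LD.
rewrite si_sqD// -mulr_natl.
have := CauchySchwarz Lx Ly; rewrite ler_norml => /andP[_].
by lra.
Qed.

Lemma seminormN x : L x -> seminorm B (- x) = seminorm B x.
Proof. by move=> Lx; rewrite /seminorm siNl ?siNr ?opprK//; exact: subspaceN. Qed.

Lemma seminormBC x y : L x -> L y -> seminorm B (x - y) = seminorm B (y - x).
Proof. by move=> Lx Ly; rewrite -seminormN ?opprB//; exact: LB. Qed.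

Lemma orthogonal_seminorm_le x y v : L x -> L y -> L v -> B (x - y) (y - v) = 0 ->
  seminorm B (x - y) <= seminorm B (x - v).
Proof.
move=> Lx Ly Lv xyv; have [Lxy Lyv] := (LB Lx Ly, LB Ly Lv).
rewrite ler_wsqrtr// -(subrKA y x (- v)) (si_sqD Lxy Lyv) xyv mulr0 addr0 lerDl.
exact: si_ge0.
Qed.

Lemma cvg_semi_inner (x_ : nat -> X) x y : (forall k, L (x_ k)) -> L x -> L y ->
  seminorm B (x_ k - x) @[k --> \oo] --> (0 : R) ->
  B (x_ k) y @[k --> \oo] --> B x y.
Proof.
move=> Lx_ Lx Ly cx; apply/cvgrPdistC_lt => e e0.
have /cvgr0_norm_lt/(_ _ e0) H : seminorm B (x_ k - x) * seminorm B y @[k --> \oo] --> (0 : R).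
  by rewrite -(mul0r (seminorm B y)); apply: cvgM => //; exact: cvg_cst.
near=> k; rewrite -siBl//; apply: le_lt_trans (CauchySchwarz _ Ly) _; first exact: LB.
by rewrite -[X in X < _]ger0_norm ?mulr_ge0 ?seminorm_ge0//; near: k.
Unshelve. all: by end_near. Qed.

(* Riesz representation only needs completeness along minimizing sequences,
   which can be chosen to converge geometrically. *)
Definition fast_complete M := forall x_ : nat -> X, (forall k, M (x_ k)) ->
  (forall k, seminorm B (x_ k.+1 - x_ k) <= 2^-1 ^+ k) ->
  exists2 x, M x & seminorm B (x_ k - x) @[k --> \oo] --> (0 : R).

Lemma Riesz_representation M (l : X -> R) (C : R) :
  subspace M -> M `<=` L -> fast_complete M ->
  (forall x y, M x -> M y -> l (x + y) = l x + l y) ->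
  (forall a x, M x -> l (a *: x) = a * l x) ->
  (forall x, M x -> `|l x| <= C * seminorm B x) ->
  exists2 u, M u & forall v, M v -> B u v = l v.
Proof.
move=> sM ML cM lD lZ lC; case: (sM) => M0 MD MZ.
have MB x y : M x -> M y -> M (x - y) by exact: subspaceB.
pose J v := B v v - 2 * l v.
have J_ge v : M v -> - C ^+ 2 <= J v.
  move=> Mv; rewrite /J -sqr_seminorm; last exact: ML.
  have := lC _ Mv; rewrite ler_norml => /andP[_].
  have := sqr_ge0 (seminorm B v - C); nra.
pose S := [set J v | v in M].
have infS : has_inf S.
  by split; [exists (J 0), 0|exists (- C ^+ 2) => _ [v Mv <-]; exact: J_ge].
have J_inf v : M v -> inf S <= J v by move=> Mv; apply: ge_inf; [case: infS|exists v].
pose dl k : R := 4^-1 * (2^-1 ^+ k) ^+ 2.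
have dl0 k : 0 < dl k by rewrite mulr_gt0// exprn_gt0// exprn_gt0.
have /choice[x_ Hx] k : exists v, M v /\ J v < inf S + dl k.
  by have [_ [v Mv <-] vk] := inf_adherent (dl0 k) infS; exists v.
have Mx k : M (x_ k) by case: (Hx k).
have cx k : seminorm B (x_ k.+1 - x_ k) <= 2^-1 ^+ k.
  rewrite -ler_sqr ?nnegrE ?seminorm_ge0 ?exprn_ge0//.
  rewrite sqr_seminorm; last by apply: ML; exact: MB.
  set v := x_ k.+1; set w := x_ k.
  have [Mv Mw] : M v /\ M w by split; exact: Mx.
  have [Lv Lw] : L v /\ L w by split; exact: ML.
  have Jh : inf S <= J (2^-1 *: (v + w)) by apply: J_inf; apply: MZ; exact: MD.
  have Jv : J v < inf S + dl k.+1 by case: (Hx k.+1).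
  have Jw : J w < inf S + dl k by case: (Hx k).
  have ldl : dl k.+1 <= dl k.
    by rewrite ler_pM2l// ler_sqr ?nnegrE ?exprn_ge0// exprS ger_pMl ?exprn_gt0//; lra.
  have Jm : J (2^-1 *: (v + w)) = 4^-1 * (B v v + 2 * B v w + B w w) - (l v + l w).
    have Lvw := LD Lv Lw; have Lhvw := LZ 2^-1 Lvw.
    rewrite /J siZl// siZr// si_sqD// lZ ?lD//; last exact: MD.
    by field.
  move: Jh Jv Jw ldl; rewrite Jm si_sqB// /J {2 4}/dl.
  set q := (2^-1 ^+ k) ^+ 2; set p := dl k.+1; lra.
have [u Mu ux] := cM x_ Mx cx.
exists u => // v Mv; apply/eqP; rewrite -subr_eq0; apply/eqP.
have [Lu Lv] : L u /\ L v by split; exact: ML.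
apply: (@quadratic_ge0_eq0 (B v v)); first exact: si_ge0.
move=> t.
have Bk : B (x_ k) v @[k --> \oo] --> B u v by apply: cvg_semi_inner => // k; exact: ML.
have dlk : dl k @[k --> \oo] --> (0 : R).
  have ck : (2^-1 : R) ^+ k @[k --> \oo] --> (0 : R) by apply: cvg_expr; rewrite ger0_norm; lra.
  rewrite [X in _ --> X](_ : 0 = 4^-1 * (0 * 0)); last by rewrite !mulr0.
  by apply: cvgM; [exact: cvg_cst|exact: cvgM].
have cv : t ^+ 2 * B v v + 2 * t * (B (x_ k) v - l v) + dl k @[k --> \oo]
    --> t ^+ 2 * B v v + 2 * t * (B u v - l v) + 0.
  apply: cvgD => //; apply: cvgD; first exact: cvg_cst.
  by apply: cvgM; [exact: cvg_cst|apply: cvgB => //; exact: cvg_cst].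
rewrite addr0 in cv; rewrite -(cvg_lim _ cv)//.
apply: limr_ge; first by apply/cvg_ex; eexists; exact: cv.
apply: nearW => k.
have Lk : L (x_ k) by exact: ML.
have H1 := J_inf _ (MD _ _ (Mx k) (MZ t _ Mv)).
have H2 : J (x_ k) < inf S + dl k by case: (Hx k).
have Ltv := LZ t Lv; have Mtv := MZ t _ Mv.
move: H1 H2; rewrite /J si_sqD// siZr// siZl// siZr// lD// lZ//.
by lra.
Qed.

Definition semi_closure (S : set X) : set X :=
  [set u | L u /\ forall e : R, 0 < e -> exists2 v, S v & seminorm B (u - v) < e].

Lemma subset_semi_closure S : S `<=` L -> S `<=` semi_closure S.
Proof.
move=> SL v Sv; split=> [|e e0]; first exact: SL.
exists v => //; rewrite /seminorm siBl; [|exact: SL|exact: SL|by apply: LB; exact: SL].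
by rewrite subrr sqrtr0.
Qed.

Lemma semi_closure_eq0 S (l : X -> R) (C : R) : S `<=` L ->
  (forall u v, L u -> S v -> `|l u - l v| <= C * seminorm B (u - v)) ->
  (forall v, S v -> l v = 0) -> forall u, semi_closure S u -> l u = 0.
Proof.
move=> SL lC l0 u [Lu uS]; apply/eqP; rewrite -normr_eq0; apply/negPn/negP => lu0.
have lu : 0 < `|l u| by rewrite lt_neqAle eq_sym lu0 normr_ge0.
have C1 : 0 < `|C| + 1 by rewrite ltr_pwDr.
have [v Sv] := uS (`|l u| / (`|C| + 1)) (divr_gt0 lu C1).
rewrite ltr_pdivlMr// => uv; have := lC u v Lu Sv; rewrite (l0 v Sv) subr0.
have := seminorm_ge0 (u - v); have := ler_norm C; nra.
Qed.

Lemma subspace_semi_closure S : S `<=` L -> subspace S -> subspace (semi_closure S).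
Proof.
move=> SL sS; case: (sS) => S0 SD SZ; split.
- by apply: subset_semi_closure.
- move=> x y [Lx xS] [Ly yS]; split; first exact: LD.
  move=> e e0; have e2 : 0 < e / 2 by rewrite divr_gt0.
  have [[v Sv xv] [w Sw yw]] := (xS _ e2, yS _ e2).
  exists (v + w); first exact: SD.
  rewrite opprD addrACA; apply: le_lt_trans (ler_seminormD _ _) _;
    [by apply: LB => //; exact: SL|by apply: LB => //; exact: SL|lra].
- move=> a x [Lx xS]; split; first exact: LZ.
  move=> e e0; have a1 : 0 < `|a| + 1 by rewrite ltr_pwDr.
  have [v Sv xv] := xS (e / (`|a| + 1)) (divr_gt0 e0 a1).
  exists (a *: v); first exact: SZ.
  have Lxv : L (x - v) by apply: LB => //; exact: SL.
  rewrite -scalerBr /seminorm siZl ?siZr//; last exact: LZ.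
  rewrite mulrA -expr2 sqrtrM ?sqr_ge0// sqrtr_sqr -/(seminorm B (x - v)).
  move: xv; rewrite ltr_pdivlMr//; have := seminorm_ge0 (x - v); nra.
Qed.

Lemma fast_complete_semi_closure S : S `<=` L -> fast_complete L -> fast_complete (semi_closure S).
Proof.
move=> SL cL x_ Sx_ x_C; have Lx_ k : L (x_ k) by case: (Sx_ k).
have [x Lx x_x] := cL x_ Lx_ x_C.
exists x => //; split=> // e e0; have e2 : 0 < e / 2 by rewrite divr_gt0.
have /cvgr0_norm_lt/(_ _ e2)[n _ /(_ n (leqnn _))] := x_x.
rewrite ger0_norm ?seminorm_ge0// => xn.
have [_ /(_ _ e2)[v Sv xv]] := Sx_ n; exists v => //.
rewrite -(subrKA (x_ n)); have Lv := SL _ Sv.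
apply: le_lt_trans (ler_seminormD _ _) _; [exact: LB|exact: LB|].
by rewrite seminormBC//; lra.
Qed.

End semi_inner_product.

Lemma semi_innerP {R : realType} {X : lmodType R} (L : set X) (B : X -> X -> R) :
  subspace L -> (forall x y, B x y = B y x) ->
  (forall a x y z, L x -> L y -> L z -> B (a *: x + y) z = a * B x z + B y z) ->
  (forall x, L x -> 0 <= B x x) -> semi_inner L B.
Proof.
move=> sL BC BD B0; case: (sL) => L0 LD LZ.
have B0z z : L z -> B 0 z = 0.
  by move=> Lz; have := BD (-1) 0 0 z L0 L0 Lz; rewrite scaler0 add0r mulN1r addNr.
split=> // [x y z Lx Ly Lz|a x z Lx Lz].
  by rewrite -[x]scale1r BD// mul1r scale1r.
by rewrite -[a *: x]addr0 BD// B0z// addr0.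
Qed.

(** * Boxes and Borel sets *)

Section boxes.
Context {R : realType} {d : nat}.
Local Notation mu := (@lebesgue_rV R d).
Implicit Types (a b : 'I_d -> R) (U : set 'rV[R]_d).

Definition box a b : set 'rV[R]_d := [set x | forall i, x ord0 i \in `]a i, b i]].

Definition cbox a b : set 'rV[R]_d := [set x | forall i, x ord0 i \in `[a i, b i]].

Definition boxes : set (set 'rV[R]_d) := [set box ab.1 ab.2 | ab in [set: ('I_d -> R) * ('I_d -> R)]].

Lemma measurable_box a b : measurable (box a b).
Proof.
rewrite [X in measurable X](_ : _ = \bigcap_(i in [set: 'I_d])
  ((fun x : 'rV[R]_d => x ord0 i) @^-1` `]a i, b i])).
  apply: fin_bigcap_measurable => // i _.
  by rewrite -[X in measurable X]setTI; exact: measurable_rV_coord.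
by apply/seteqP; split => [x xab i _|x xab i]; [exact: xab|exact: (xab i)].
Qed.

Lemma setI_box a b a' b' : box a b `&` box a' b' =
  box (fun i => Num.max (a i) (a' i)) (fun i => Num.min (b i) (b' i)).
Proof.
apply/seteqP; split => [x [H H'] i|x H].
  by have := H i; have := H' i; rewrite !in_itv/= gt_max le_min => /andP[-> ->] /andP[-> ->].
by split=> i; have := H i; rewrite !in_itv/= gt_max le_min => /andP[/andP[? ?] /andP[? ?]]; apply/andP.
Qed.

Lemma setI_closed_boxes : setI_closed boxes.
Proof.
move=> _ _ [[a b] _ <-] [[a' b'] _ <-]; rewrite setI_box.
by exists ((fun i => Num.max (a i) (a' i)), (fun i => Num.min (b i) (b' i))).
Qed.

Lemma rV_bounded (x : 'rV[R]_d) : exists n : nat, forall i, `|x ord0 i| < n%:R.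
Proof.
pose M := \sum_(i < d) `|x ord0 i|.
have M0 : 0 <= M by apply: sumr_ge0.
exists (Num.truncn M).+1 => i; apply: le_lt_trans (truncnS_gt M).
by rewrite /M (bigD1 i)//= lerDl sumr_ge0.
Qed.

Lemma bigcup_box : \bigcup_n box (fun=> - n%:R) (fun=> n%:R) = [set: 'rV[R]_d].
Proof.
rewrite -subTset => x _; have [n xn] := rV_bounded x.
by exists n => // i; have := xn i; rewrite ltr_norml in_itv/= => /andP[-> /ltW].
Qed.

Lemma measurable_rVE : @measurable _ 'rV[R]_d = <<s boxes >>.
Proof.
apply/seteqP; split; last first.
  apply: smallest_sub; first exact: sigma_algebra_measurable.
  by move=> _ [[a b] _ <-]; exact: measurable_box.
apply: smallest_sub; first exact: smallest_sigma_algebra.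
rewrite -bigcup_seq/=; apply: bigcup_sub => i _.
have : measurable_fun [set: g_sigma_algebraType boxes] (fun x : g_sigma_algebraType boxes => (x : 'rV[R]_d) ord0 i).
  apply: (@measurability _ _ _ _ _ _ (@RGenOInfty.G R)).
    exact: RGenOInfty.measurableE.
  move=> _ [_ [c ->] <-]; rewrite setTI.
  have -> : (fun x : g_sigma_algebraType boxes => (x : 'rV[R]_d) ord0 i) @^-1` `]c, +oo[%classic =
    \bigcup_n box (fun j => if j == i then c else - n%:R) (fun=> n%:R).
    apply/seteqP; split => [x/=|x/= [n _ /(_ i)]]; last first.
      by rewrite !in_itv/= eqxx andbT => /andP[].
    rewrite in_itv/= andbT => cx.
    have [n xn] := rV_bounded x; exists n => // j; have := xn j.
    by rewrite ltr_norml in_itv/= => /andP[xl xr]; rewrite (ltW xr) andbT; case: eqP => [->|].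
  apply: bigcupT_measurable => n; apply: sub_sigma_algebra.
  by exists (fun j => if j == i then c else - n%:R, fun=> n%:R).
move=> mi _ [Y mY <-]; exact: mi.
Qed.

Lemma open_box_cover U : open U -> exists (I : countType) (a b : I -> 'I_d -> R) (e : I -> R),
  [/\ (forall k, 0 < e k), U = \bigcup_k box (a k) (b k) &
      forall k, cbox (a k) (fun i => b k i + e k) `<=` U].
Proof.
move=> oU.
pose I0 : countType := ('rV[rat]_d * nat)%type.
pose e0 (k : I0) : R := k.2.+1%:R^-1.
pose a0 (k : I0) i : R := ratr (k.1 ord0 i) - e0 k.
pose b0 (k : I0) i : R := ratr (k.1 ord0 i) + e0 k.
have e00 k : 0 < e0 k by rewrite invr_gt0.
pose P k := `[< cbox (a0 k) (fun i => b0 k i + e0 k) `<=` U >].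
exists {k : I0 | P k}, (fun k => a0 (val k)), (fun k => b0 (val k)), (fun k => e0 (val k)).
split => //; last by move=> [k /= /asboolP].
apply/seteqP; split => [x Ux|x [[k /= /asboolP kU] _ /= xk]]; last first.
  apply: kU => i; have := xk i; rewrite !in_itv/= => /andP[/ltW ->/=] /le_trans; apply.
  by rewrite lerDl ltW.
have /nbhs_ballP[r /= r0 rU] : nbhs x U by exact: open_nbhs_nbhs.
pose n := Num.truncn (3 / r).
have en : n.+1%:R^-1 < r / 3.
  rewrite invf_plt ?posrE ?divr_gt0// invf_div; exact: truncnS_gt.
have /choice[q Hq] i : exists q, ratr q \in `]x ord0 i - n.+1%:R^-1, x ord0 i + n.+1%:R^-1[.
  apply: rat_in_itvoo; rewrite ltrD2l gtrN// invr_gt0 ltr0n//.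
pose k : I0 := (\row_i q i, n).
have Pk : P k.
  apply/asboolP => y yk; apply: rU; split=> // i j; rewrite (ord1 i).
  have := yk j; have := Hq j; rewrite !in_itv/= /a0 /b0 /e0 /k/= !mxE.
  set v := _^-1 in en *.
  rewrite /ball/= ltr_norml => /andP[? ?] /andP[? ?]; apply/andP; split; lra.
exists (exist _ k Pk) => //= i; have := Hq i.
rewrite !in_itv/= /a0 /b0 /e0 /k/= !mxE; set v := _^-1.
by move=> /andP[? ?]; apply/andP; split; lra.
Qed.

Lemma open_measurable_rV U : open U -> measurable U.
Proof.
move=> /open_box_cover[I [a [b [e [_ -> _]]]]].
apply: countable_bigcupT_measurable; first exact: countableP.
by move=> k; exact: measurable_box.
Qed.

Lemma closed_measurable_rV U : closed U -> measurable U.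
Proof. by move=> cU; rewrite -(setCK U); apply: measurableC; apply: open_measurable_rV; exact: closed_openC. Qed.

Lemma continuous_measurable_rV (f : 'rV[R]_d -> R) :
  continuous f -> measurable_fun setT f.
Proof.
move=> /continuousP cf; apply: (@measurability _ _ _ _ _ _ (@RGenOInfty.G R)).
  exact: RGenOInfty.measurableE.
move=> _ [_ [c ->] <-]; rewrite setTI.
by apply: open_measurable_rV; apply: cf; rewrite set_itvoy; exact: open_gt.
Qed.

Lemma lebesgue_box_lty a b : (mu (box a b) < +oo)%E.
Proof.
have H : box a b `<=` box (fun i => - (`|a i| + `|b i|)) (fun i => `|a i| + `|b i|).
  move=> x xab i; have := xab i; rewrite !in_itv/= => /andP[ax xb].
  have := ler_norm (b i); have := ler_norm (- a i); rewrite normrN; have := normr_ge0 (a i); have := normr_ge0 (b i).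
  by move=> ? ? ? ?; apply/andP; split; lra.
apply: (@le_lt_trans _ _ (mu (box (fun i => - (`|a i| + `|b i|)) (fun i => `|a i| + `|b i|)))).
  by apply: le_measure => //; rewrite inE; exact: measurable_box.
by rewrite lebesgue_rV_box ?ltry// => i; have := normr_ge0 (a i); have := normr_ge0 (b i); lra.
Qed.

Lemma bounded_set_box U : bounded_set U -> exists n : nat, U `<=` box (fun=> - n%:R) (fun=> n%:R).
Proof.
move=> [M [Mreal UM]]; exists (Num.truncn (`|M| + 1)).+1 => x Ux i.
have : `|x| <= `|M| + 1 by apply: UM => //; rewrite (le_lt_trans (ler_norm _))// ltrDl.
move=> xM; have xi : `|x ord0 i| <= `|x|.
  rewrite [leRHS]/Num.norm /= mx_normrE; apply/bigmax_geP; right => /=.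
  by exists (ord0, i).
have := truncnS_gt (`|M| + 1); move: xi; rewrite in_itv/= ler_norml => /andP[? ?] ?.
by apply/andP; split; lra.
Qed.

Lemma lebesgue_bounded_lty U : measurable U -> bounded_set U -> (mu U < +oo)%E.
Proof.
move=> mU /bounded_set_box[n Un]; apply: le_lt_trans (lebesgue_box_lty (fun=> - n%:R) (fun=> n%:R)).
by apply: le_measure => //; rewrite inE//; exact: measurable_box.
Qed.

End boxes.

(** * Translation invariance *)

Section translation.
Context {R : realType} {d : nat}.
Local Notation mu := (@lebesgue_rV R d).
Implicit Types (a b : 'I_d -> R) (h : 'rV[R]_d) (f : 'rV[R]_d -> R).

Lemma measurable_shift_rV h : measurable_fun setT (fun x : 'rV[R]_d => x + h).
Proof.
apply: measurable_fun_rVP => i; under eq_fun do rewrite mxE.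
by apply: measurable_funD => //; exact: measurable_rV_coord.
Qed.

Lemma lebesgue_rV_shift h A : measurable A ->
  pushforward mu (fun x : 'rV[R]_d => x + h) A = mu A.
Proof.
move=> mA; pose mu' := measure_function_pushforward__canonical__measure_function_Measure mu (measurable_shift_rV h).
rewrite -[LHS]/(mu' A).
apply: (measure_unique boxes (fun n => box (fun=> - n%:R) (fun=> n%:R))) => //.
- exact: measurable_rVE.
- exact: setI_closed_boxes.
- by move=> n; exists (fun=> - n%:R, fun=> n%:R).
- exact: bigcup_box.
- move=> _ [[a b] _ <-]/=; rewrite /pushforward.
  have -> : (fun x : 'rV[R]_d => x + h) @^-1` box a b =
      box (fun i => a i - h ord0 i) (fun i => b i - h ord0 i).
    apply/seteqP; split => x H i; have := H i; rewrite !in_itv/= !mxE => /andP[? ?];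
    by apply/andP; split; lra.
  have [ab|/existsNP[i /negP]] := pselect (forall i, a i <= b i).
    rewrite !lebesgue_rV_box//; last by move=> i; rewrite lerD2r.
    by congr EFin; apply: eq_bigr => i _; ring.
  rewrite -ltNge => ba.
  have E a' b' : b' i < a' i -> box a' b' = set0 :> set 'rV[R]_d.
    move=> ba'; apply/seteqP; split => // x /(_ i); rewrite in_itv/= => /andP[? ?].
    by exfalso; move: ba'; apply/negP; rewrite -leNgt; lra.
  by rewrite !E ?measure0//; lra.
- move=> k; rewrite /= /pushforward.
  apply: le_lt_trans (lebesgue_box_lty (fun i => - k%:R - h ord0 i) (fun i => k%:R - h ord0 i)).
  apply: le_measure; rewrite ?inE; [|exact: measurable_box|].
    by rewrite -[X in measurable X]setTI; apply: measurable_shift_rV => //; exact: measurable_box.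
  move=> x H i; have := H i; rewrite !in_itv/= !mxE => /andP[? ?].
  by apply/andP; split; lra.
Qed.

Lemma bounded_integrable (D : set 'rV[R]_d) f (C : R) :
  measurable D -> (mu D < +oo)%E -> measurable_fun D f ->
  (forall x, D x -> `|f x| <= C) -> mu.-integrable D (EFin \o f).
Proof.
move=> mD Doo mf fC; apply: measurable_bounded_integrable => //.
exists C; split; first exact: num_real.
by move=> M CM x Dx; apply: (le_trans (fC _ Dx)); exact: ltW.
Qed.

Lemma integrable_setTP (D : set 'rV[R]_d) f : measurable D ->
  (forall x, ~ D x -> f x = 0) ->
  mu.-integrable D (EFin \o f) <-> mu.-integrable setT (EFin \o f).
Proof.
move=> mD f0; rewrite integrable_mkcond// (_ : _ \_ D = EFin \o f)//.
by apply/funext => x; rewrite patchE; case: ifPn => // /negP xD /=; rewrite f0// => /mem_set.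
Qed.

Lemma Rintegral_setT (D : set 'rV[R]_d) f :
  (forall x, ~ D x -> f x = 0) ->
  \int[mu]_(x in D) f x = \int[mu]_x f x.
Proof.
move=> f0; rewrite Rintegral_mkcond; apply: eq_Rintegral => x _.
by rewrite patchE; case: ifPn => // /negP xD; rewrite f0// => /mem_set.
Qed.

Lemma integral_shift f h : measurable_fun setT f ->
  mu.-integrable setT (EFin \o f) -> mu.-integrable setT (EFin \o (fun x => f (x + h))) /\
  \int[mu]_x f (x + h) = \int[mu]_x f x.
Proof.
move=> mf intf.
have mE : measurable_fun setT (EFin \o f) by exact/measurable_EFinP.
pose mu' := measure_function_pushforward__canonical__measure_function_Measure mu (measurable_shift_rV h).
have i' : mu.-integrable setT (EFin \o (fun x => f (x + h))).
  apply/integrableP; split.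
    apply/measurable_EFinP; apply: (measurableT_comp mf); exact: measurable_shift_rV.
  have mn : measurable_fun setT (fun y => `|(EFin \o f) y|)%E.
    exact: measurableT_comp.
  have := @ge0_integral_pushforward _ _ _ _ _ _ (measurable_shift_rV h) mu setT (fun y => `|(EFin \o f) y|)%E.
  rewrite preimage_setT => <- //.
  have -> : (\int[pushforward mu (fun x : 'rV[R]_d => (x + h)%R)]_y `|(EFin \o f) y| = \int[mu]_y `|(EFin \o f) y|)%E.
    by apply: (@eq_measure_integral _ _ _ _ mu mu') => A mA _ /=; exact: lebesgue_rV_shift.
  by case/integrableP : intf.
split=> //; rewrite /Rintegral; congr fine.
have := @integral_pushforward _ _ _ _ _ _ (measurable_shift_rV h) mu setT (EFin \o f) mE.
rewrite preimage_setT => /(_ i' measurableT) <-.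
by apply: (@eq_measure_integral _ _ _ _ mu mu') => A mA _ /=; exact: lebesgue_rV_shift.
Qed.

End translation.

(** * Integrals of partial derivatives *)

Section divergence.
Context {R : realType} {d : nat}.
Local Notation mu := (@lebesgue_rV R d).
Implicit Types (a b : 'I_d -> R) (v x : 'rV[R]_d) (F G : 'rV[R]_d -> R).

Lemma is_derive_line F v x (t l : R) : is_derive (t *: v + x) v F l ->
  is_derive t 1 (fun s => F (s *: v + x)) l.
Proof.
move=> [dF <-]; have E : (fun h : R => h^-1 *: (((fun s => F (s *: v + x)) \o shift t) (h *: 1) - F (t *: v + x))) =
   (fun h => h^-1 *: ((F \o shift (t *: v + x)) (h *: v) - F (t *: v + x))).
  by apply/funext => h /=; rewrite [h%:A]mulr1 scalerDl addrA.
by apply: DeriveDef; rewrite ?/derive ?/derivable E.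
Qed.

Lemma compact_cbox a b : compact (cbox a b).
Proof. by apply: (@rV_compact _ _ (fun i => `[a i, b i]%classic)) => i; exact: segment_compact. Qed.

Lemma closed_cbox a b : closed (cbox a b).
Proof. by apply: compact_closed; [exact: norm_hausdorff|exact: compact_cbox]. Qed.

Lemma continuous_compact_bounded F (K : set 'rV[R]_d) : continuous F -> compact K ->
  exists C, forall x, K x -> `|F x| <= C.
Proof.
move=> cF cK.
have /compact_bounded[M [_ HM]] : compact (F @` K).
  by apply: continuous_compact => //; exact: continuous_subspaceT.
by exists (M + 1) => x Kx; apply: (HM (M + 1)); [rewrite ltrDl|exists x].
Qed.

Lemma measurable_cbox a b : measurable (cbox a b).
Proof. apply: closed_measurable_rV; exact: closed_cbox. Qed.

Lemma lebesgue_cbox_lty a b : (mu (cbox a b) < +oo)%E.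
Proof.
apply: lebesgue_bounded_lty; first exact: measurable_cbox.
exact: (@compact_bounded R 'rV[R]_d _ (@compact_cbox a b)).
Qed.

Lemma continuous_cbox_integrable F a b : continuous F ->
  (forall x, ~ cbox a b x -> F x = 0) -> mu.-integrable setT (EFin \o F).
Proof.
move=> cF F0; have [C FC] := continuous_compact_bounded cF (@compact_cbox a b).
apply/(integrable_setTP (@measurable_cbox a b)) => //.
apply: (bounded_integrable _ _ _ FC); [exact: measurable_cbox|exact: lebesgue_cbox_lty|].
apply: measurable_funTS; exact: continuous_measurable_rV.
Qed.

Lemma integral_partial_eq0 F G j (M : R) : continuous F -> continuous G ->
  (forall x, is_derive x (delta_mx ord0 j) F (G x)) ->
  (forall x, ~ cbox (fun=> - M) (fun=> M) x -> F x = 0) ->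
  (forall x, ~ cbox (fun=> - M) (fun=> M) x -> G x = 0) ->
  \int[mu]_x G x = 0.
Proof.
move=> cF cG dF F0 G0; set e := delta_mx ord0 j in dF.
pose M' := M + 1.
have [C GC] := continuous_compact_bounded cG (@compact_cbox (fun=> - M) (fun=> M)).
have GC' x : `|G x| <= `|C|.
  have [/GC H|/G0 ->] := pselect (cbox (fun=> - M) (fun=> M) x).
    exact: le_trans H (ler_norm _).
  by rewrite normr0.
pose f t x := F (t *: e + x).
pose D : set 'rV[R]_d := cbox (fun=> - M') (fun=> M').
have fD (t : R) x : t \in `]-1, 1[ -> ~ D x -> ~ cbox (fun=> - M) (fun=> M) (t *: e + x).
  rewrite in_itv/= => /andP[t1 t2] Dx H; apply: Dx => i; have := H i.
  rewrite !in_itv/= !mxE eqxx/= /M'.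
  by case: (_ == _); rewrite ?mulr1 ?mulr0 => /andP[? ?]; apply/andP; split; lra.
have df (t : R) x : is_derive t 1 (f^~ x) (G (t *: e + x)).
  by apply: is_derive_line; exact: dF.
have iF : mu.-integrable setT (EFin \o F) by exact: continuous_cbox_integrable F0.
have mF : measurable_fun setT F by exact: continuous_measurable_rV.
have intf (t : R) : mu.-integrable setT (EFin \o f t).
  have [+ _] := integral_shift (t *: e) mF iF.
  by congr (integrable _ _ _); apply/funext => x/=; rewrite /f addrC.
pose H x : R := `|C| * \1_D x.
have mD : measurable D by exact: measurable_cbox.
have := @differentiation_under_integral R _ _ mu f setT measurableT 0 (-1) 1 _ _ _ H _ _ _.
rewrite /partial1of2 => E.
have -> : \int[mu]_x G x = \int[mu]_x (derive1 (f^~ x) 0).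
  by apply: eq_Rintegral => x _; rewrite derive1E (@derive_val _ _ _ _ _ _ _ (df 0 x)) scale0r add0r.
rewrite -E => {E}.
- rewrite (_ : (fun t => _) = cst (\int[mu]_x F x)) ?derive1_cst//.
  apply/funext => t /=; have [_ <-] := integral_shift (t *: e) mF iF.
  by apply: eq_Rintegral => x _; rewrite /f addrC.
- by rewrite /= in_itv/= ltrN10 ltr01.
- by move=> t _; exact: intf.
- by move=> t x _ _; case: (df t x).
- by move=> x; rewrite /H mulr_ge0// indicE ler0n.
- apply/(integrable_setTP mD); first by move=> x Dx; rewrite /H indicE memNset// mulr0.
  apply: (@bounded_integrable _ _ _ _ `|C|) => //; first exact: lebesgue_cbox_lty.
    by apply: measurable_funM => //; exact: measurable_indic.
  by move=> x Dx; rewrite /H indicE mem_set// mulr1 normr_id.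
- move=> t x It _; rewrite derive1E (@derive_val _ _ _ _ _ _ _ (df t x)) /H indicE.
  have [Dx|nDx] := pselect (D x); first by rewrite mem_set// mulr1.
  by rewrite G0 ?normr0 ?mulr_ge0//; exact: fD.
Qed.

End divergence.

(** * Smooth bumps *)

Section smooth_one_variable.
Context {R : realType}.
Implicit Types (h k : R -> R) (n m : nat).

Fixpoint diff_upto n h : Prop := if n is m.+1 then
  exists2 h', (forall x : R, is_derive x 1 h (h' x)) & diff_upto m h'
  else continuous h.

Definition smooth1 h := forall n, diff_upto n h.

Lemma diff_upto_continuous n h : diff_upto n h -> continuous h.
Proof.
case: n => [//|n [h' dh _]] x; apply: differentiable_continuous.
by apply/derivable1_diffP; case: (dh x).
Qed.

Lemma diff_uptoS n h : diff_upto n.+1 h -> diff_upto n h.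
Proof.
elim: n h => [h|n IH h [h' dh h'n]]; first exact: diff_upto_continuous.
by exists h' => //; exact: IH.
Qed.

Lemma diff_uptoD n h k : diff_upto n h -> diff_upto n k ->
  diff_upto n (fun x => h x + k x).
Proof.
elim: n h k => [h k /= ch ck x|n IH h k [h' dh h'n] [k' dk k'n]].
  by apply: cvgD; [exact: ch|exact: ck].
exists (fun x => h' x + k' x); last exact: IH.
by move=> x; exact: is_deriveD.
Qed.

Lemma diff_uptoM n h k : diff_upto n h -> diff_upto n k ->
  diff_upto n (fun x => h x * k x).
Proof.
elim: n h k => [h k /= ch ck x|n IH h k hn kn].
  by apply: cvgM; [exact: ch|exact: ck].
case: (hn) (kn) => h' dh h'n [k' dk k'n].
exists (fun x => h x * k' x + k x * h' x).
  by move=> x; exact: is_deriveM.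
by apply: diff_uptoD; apply: IH => //; exact: diff_uptoS.
Qed.

Lemma diff_upto_cst n (c : R) : diff_upto n (fun=> c).
Proof.
elim: n c => [c x|n IH c]; first exact: cvg_cst.
by exists (fun=> 0) => // x; exact: is_derive_cst.
Qed.

Lemma diff_upto_affine n h (c b : R) : diff_upto n h ->
  diff_upto n (fun x => h (c * x + b)).
Proof.
elim: n h => [h ch x|n IH h [h' dh h'n]].
  apply: (@continuous_comp _ _ _ (fun x => c * x + b) h); last exact: ch.
  by apply: cvgD; [apply: cvgM; [exact: cvg_cst|exact: cvg_id]|exact: cvg_cst].
exists (fun x => h' (c * x + b) * c); last first.
  by apply: diff_uptoM; [exact: IH|exact: diff_upto_cst].
move=> x; apply: (@is_derive1_comp _ h (fun x => c * x + b) x (h' (c * x + b)) c).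
by apply: is_derive_eq; rewrite /GRing.scale/=; ring.
Qed.

Definition flat n (t : R) : R := if 0 < t then t^-1 ^+ n * expR (- t^-1) else 0.

Lemma flat_ge0 n t : 0 <= flat n t.
Proof. by rewrite /flat; case: ifP => // t0; rewrite mulr_ge0 ?expR_ge0// exprn_ge0// invr_ge0 ltW. Qed.

Lemma flatS_le n t : flat n.+1 t <= n.+1`!%:R.
Proof.
rewrite /flat; case: ifP => [t0|]; last by rewrite ler0n.
have s0 : 0 < t^-1 by rewrite invr_gt0.
rewrite expRN ler_pdivrMr ?expR_gt0// -ler_pdivrMl ?ltr0n ?fact_gt0//.
rewrite mulrC; apply: le_trans (expR_ge1Dxn n (ltW s0)).
by rewrite lerDr.
Qed.

Lemma flatM n t : t * flat n.+1 t = flat n t.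
Proof.
rewrite /flat; case: ifP => [t0|]; last by rewrite mulr0.
by rewrite mulrA exprS mulrA divff ?mul1r ?gt_eqF.
Qed.

Lemma is_derive_flat n (t : R) : is_derive t 1 (flat n) (flat n.+2 t - n%:R * flat n.+1 t).
Proof.
have [t0|t0|->] := ltgtP t 0.
- have -> : flat n.+2 t - n%:R * flat n.+1 t = 0.
    by rewrite /flat ltNge (ltW t0)/= mulr0 subr0.
  apply: (@near_eq_is_derive _ _ _ (cst 0)).
  near=> s; rewrite /flat ltNge ifF//; apply/negbF; near: s.
  have := @lt_nbhsl _ t 0 t0; apply: filterS => s; exact: ltW.
- apply: (@near_eq_is_derive _ _ _ (((fun s : R => s^-1) ^+ n) * (expR \o (fun s : R => - s^-1)))).
    near=> s; rewrite /flat ifT; first by rewrite exprfctE.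
    near: s; exact: lt_nbhsr.
  have tn0 : t != 0 by rewrite gt_eqF.
  have dV : is_derive t 1 (fun s : R => s^-1) (- t ^- 2).
    by have := @is_deriveV R (fun s => s) t 1 1 tn0 (is_derive_id t 1); rewrite /GRing.scale/= mulr1.
  have dN : is_derive t 1 (fun s : R => - s^-1) (t ^- 2).
    by apply: is_derive_eq; rewrite opprK.
  have dE := @is_derive1_comp R expR (fun s => - s^-1) t _ _ (is_derive_expR (- t^-1)) dN.
  have dX := @is_deriveX _ _ (fun s : R => s^-1) n t 1 _ dV.
  apply: (is_derive_eq (is_deriveM dX dE)).
  rewrite /flat t0 /GRing.scale/= exprfctE.
  case: n {dX} => [|n]; rewrite /= !exprS ?expr0; first by field.
  by set p := _ ^+ n; field.
- have -> : flat n.+2 0 - n%:R * flat n.+1 0 = 0 by rewrite /flat ltxx mulr0 subr0.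
  have q0 : h^-1 *: ((flat n \o shift 0) (h *: 1) - flat n 0) @[h --> 0^'] --> (0 : R).
    apply/cvgr0Pnorm_lt => e e0.
    near=> h.
    have h0 : h != 0 by near: h; exact: nbhs_dnbhs_neq.
    have f0 : flat n 0 = 0 by rewrite /flat ltxx.
    rewrite /= addr0 [h%:A]mulr1 f0 subr0 -(flatM n h) -(flatM n.+1 h).
    rewrite /GRing.scale/= mulKf// normrM (ger0_norm (flat_ge0 _ _)).
    apply: (@le_lt_trans _ _ (`|h| * n.+2`!%:R)); first by rewrite ler_wpM2l// flatS_le.
    rewrite -ltr_pdivlMr ?ltr0n ?fact_gt0//; near: h.
    apply: dnbhs0_lt; rewrite divr_gt0// ltr0n fact_gt0//.
  by apply: DeriveDef; [apply/cvg_ex; exists 0|exact: cvg_lim].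
Unshelve. all: by end_near. Qed.

Lemma smooth1_flat n : smooth1 (flat n).
Proof.
move=> m; elim: m n => [n x|m IH n].
  by apply: differentiable_continuous; apply/derivable1_diffP; case: (is_derive_flat n x).
exists (fun t => flat n.+2 t - n%:R * flat n.+1 t); first exact: is_derive_flat.
rewrite (_ : (fun _ => _) = fun t => flat n.+2 t + - n%:R * flat n.+1 t); last first.
  by apply/funext => t; rewrite mulNr.
by apply: diff_uptoD => //; apply: diff_uptoM => //; exact: diff_upto_cst.
Qed.

Lemma smooth1_continuous h : smooth1 h -> continuous h.
Proof. by move=> /(_ 0). Qed.

Lemma smooth1_derive h : smooth1 h ->
  exists2 h', (forall x : R, is_derive x 1 h (h' x)) & smooth1 h'.
Proof.
move=> hh; have [h' dh _] := hh 1; exists h' => // n.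
have [k dk kn] := hh n.+1; suff -> : h' = k by [].
by apply/funext => x; rewrite -(@derive_val _ _ _ _ _ _ _ (dh x)) (@derive_val _ _ _ _ _ _ _ (dk x)).
Qed.

Lemma smooth1M h k : smooth1 h -> smooth1 k -> smooth1 (fun x => h x * k x).
Proof. by move=> hh hk n; exact: diff_uptoM. Qed.

(* As [m] tends to infinity this converges pointwise to the indicator of
   the half-open interval from [a] to [b]; the second factor keeps the value
   at [b] from vanishing. *)
Definition bump (a b : R) m (t : R) : R :=
  flat 0 (m.+1%:R * t + - (m.+1%:R * a)) *
  flat 0 (- (m.+1%:R ^+ 2) * t + (m.+1%:R ^+ 2 * b + m.+1%:R)).

Lemma smooth1_bump a b m : smooth1 (bump a b m).
Proof. by apply: smooth1M => n; apply: diff_upto_affine; exact: smooth1_flat. Qed.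

Lemma flat_le1 t : flat 0 t <= 1.
Proof.
rewrite /flat; case: ifP => // t0; rewrite expr0 mul1r expR_le1 oppr_le0 invr_ge0 ltW//.
Qed.

Lemma bump_ge0 a b m t : 0 <= bump a b m t.
Proof. by rewrite mulr_ge0// flat_ge0. Qed.

Lemma bump_le1 a b m t : bump a b m t <= 1.
Proof. by rewrite mulr_ile1// ?flat_ge0// flat_le1. Qed.

Lemma bump_eq0 a b m t : t \notin `[a, b + m.+1%:R^-1] -> bump a b m t = 0.
Proof.
have m0 : 0 < m.+1%:R :> R by rewrite ltr0n.
rewrite in_itv/= negb_and -!ltNge /bump /flat => /orP[ta|bt].
  by rewrite ifF ?mul0r//; apply/negbTE; rewrite -leNgt -mulrBr pmulr_rle0// subr_le0 ltW.
rewrite [X in _ * X]ifF ?mulr0//; apply/negbTE; rewrite -leNgt.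
have -> : - m.+1%:R ^+ 2 * t + (m.+1%:R ^+ 2 * b + m.+1%:R) =
  m.+1%:R ^+ 2 * (b + m.+1%:R^-1 - t) by field; rewrite gt_eqF.
by rewrite pmulr_rle0 ?exprn_gt0// subr_le0 ltW.
Qed.

Lemma cvg_flat (u : nat -> R) (c : R) : 0 < c -> (\forall m \near \oo, m.+1%:R * c <= u m) ->
  flat 0 (u m) @[m --> \oo] --> (1 : R).
Proof.
move=> c0 uc; apply: (@squeeze_cvgr _ _ _ _ (fun m => expR (- (c^-1 * m.+1%:R^-1))) (cst 1)).
- near=> m; rewrite flat_le1 andbT; have H : m.+1%:R * c <= u m by near: m.
  have mc : 0 < m.+1%:R * c by rewrite mulr_gt0.
  rewrite /flat (lt_le_trans mc H) expr0 mul1r ler_expR lerN2 -invfM mulrC.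
  by rewrite lef_pV2 ?posrE// (lt_le_trans mc).
- rewrite -[X in _ --> X]expR0; apply: continuous_cvg; first exact: continuous_expR.
  rewrite -[X in _ --> X]oppr0; apply: cvgN.
  rewrite -[X in _ --> X](mulr0 c^-1); apply: cvgM; first exact: cvg_cst.
  exact: (@cvg_harmonic R).
- exact: cvg_cst.
Unshelve. all: by end_near. Qed.

Lemma cvg_bump a b t :
  bump a b m t @[m --> \oo] --> (\1_`]a, b]%classic t : R).
Proof.
have m0 m : 0 < m.+1%:R :> R by rewrite ltr0n.
rewrite indicE mem_setE in_itv/=; case: (boolP (_ && _)).
  move=> /andP[at_ tb]; rewrite -[X in _ --> X](mulr1 1); apply: cvgM.
    apply: (@cvg_flat _ (t - a)); first by rewrite subr_gt0.
    by apply: nearW => m; rewrite mulrBr.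
  apply: (@cvg_flat _ 1) => //; apply: nearW => m; rewrite mulr1.
  rewrite mulNr addrA lerDr addrC -mulrBr; apply: mulr_ge0; first exact: sqr_ge0.
  by rewrite subr_ge0.
move=> tab; apply: cvg_near_cst.
have [ta|at_] := leP t a.
  near=> m; rewrite /= /bump /flat ifF ?mul0r//; apply/negbTE.
  by rewrite -leNgt -mulrBr pmulr_rle0// subr_le0.
move: tab; rewrite at_/= -ltNge => bt.
near=> m; rewrite bump_eq0// in_itv/= negb_and -!ltNge; apply/orP; right.
rewrite -ltrBrDl; near: m.
have /cvgr0_norm_lt/(_ (t - b)) := @cvg_harmonic R.
rewrite subr_gt0 => /(_ bt); apply: filterS => m; rewrite ger0_norm//= invr_ge0 ler0n//.
Unshelve. all: by end_near. Qed.

End smooth_one_variable.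

(** * The fundamental lemma of the calculus of variations *)

Section fundamental_lemma.
Context {R : realType} {d : nat}.
Local Notation mu := (@lebesgue_rV R d).
Implicit Types (a b : 'I_d -> R) (Omega : set 'rV[R]_d) (g : 'rV[R]_d -> R).

Definition tensor (h : 'I_d -> R -> R) (x : 'rV[R]_d) : R := \prod_i h i (x ord0 i).

Lemma is_derive_tensor h h' j x :
  (forall t : R, is_derive t 1 (h j) (h' t)) ->
  is_derive x (delta_mx ord0 j) (tensor h)
    (tensor (fun i => if i == j then h' else h i) x).
Proof.
move=> dh; pose c := \prod_(i < d | i != j) h i (x ord0 i).
pose k (t : R) : R := h j t * c.
have tE (s : R) : tensor h (s *: delta_mx ord0 j + x) = k (s *: 1 + x ord0 j).
  rewrite /tensor (bigD1 j)//= !mxE !eqxx/= /k; congr (_ * _).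
  by apply: eq_bigr => i ij; rewrite !mxE (negbTE ij) andbF mulr0 add0r.
have -> : tensor (fun i => if i == j then h' else h i) x = h' (x ord0 j) * c.
  rewrite /tensor (bigD1 j)//= eqxx; congr (_ * _).
  by apply: eq_bigr => i /negbTE ->.
have [dk <-] : is_derive (x ord0 j) 1 k (h' (x ord0 j) * c).
  have := @is_deriveM _ _ (h j) (cst c) (x ord0 j) 1 _ _ (dh _) (is_derive_cst _ _ _).
  by move=> /is_derive_eq; apply; rewrite /GRing.scale/= mulr0 add0r mulrC.
have E : (fun s : R => s^-1 *: ((tensor h \o shift x) (s *: delta_mx ord0 j) - tensor h x)) =
         (fun s => s^-1 *: ((k \o shift (x ord0 j)) (s *: 1) - k (x ord0 j))).
  apply/funext => s /=; rewrite tE; congr (_ *: (_ - _)).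
  by have := tE 0; rewrite !scale0r !add0r.
by apply: DeriveDef; rewrite ?/derive ?/derivable E.
Qed.

Lemma continuous_tensor h : (forall i, continuous (h i)) -> continuous (tensor h).
Proof.
move=> ch; rewrite /tensor; elim: (index_enum _) => [|i s IH].
  have -> : (fun x : 'rV[R]_d => \prod_(i <- [::]) h i (x ord0 i)) = cst (1 : R).
    by apply/funext => y; rewrite big_nil.
  exact: cst_continuous.
rewrite (_ : (fun x => _) = fun x : 'rV[R]_d => h i (x ord0 i) * \prod_(i <- s) h i (x ord0 i)); last first.
  by apply/funext => y; rewrite big_cons.
have c0 : continuous (h i \o (fun x : 'rV[R]_d => x ord0 i)).
  by move=> x; apply: continuous_comp; [exact: coord_continuous|exact: ch].
by move=> x; apply: cvgM; [exact: (@nbhs_filter 'rV[R]_d x)|exact: c0|exact: IH].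
Qed.

Lemma smooth_tensor h : (forall i, smooth1 (h i)) -> smooth (tensor h).
Proof.
move=> sh s.
suff [k sk ->] : exists2 k, (forall i, smooth1 (k i)) & iter_partial s (tensor h) = tensor k.
  split=> [|j x].
    by apply: continuous_tensor => i; exact: smooth1_continuous.
  have [k' dk _] := smooth1_derive (sk j).
  by case: (is_derive_tensor x dk).
elim: s => [|j s [k sk kE]]; first by exists h.
have [k' dk sk'] := smooth1_derive (sk j).
exists (fun i => if i == j then k' else k i); first by move=> i; case: eqP.
by apply/funext => x; rewrite /= kE /partial (@derive_val _ _ _ _ _ _ _ (is_derive_tensor x dk)).
Qed.

Lemma supp_subset (K : set 'rV[R]_d) g : closed K ->
  (forall x, ~ K x -> g x = 0) -> supp g `<=` K.
Proof.
move=> clK g0; rewrite closure_id in clK; rewrite clK; apply: closureS => x /eqP gx.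
by apply: contrapT => /g0.
Qed.

Lemma test_fun_bump Omega a b (e : R) m : m.+1%:R^-1 <= e ->
  cbox a (fun i => b i + e) `<=` Omega -> test_fun Omega (tensor (fun i => bump (a i) (b i) m)).
Proof.
move=> me KO; set phi := tensor _.
have phi0 x : ~ cbox a (fun i => b i + e) x -> phi x = 0.
  move=> xK; apply/eqP; rewrite prodf_seq_eq0; apply/hasP.
  move/existsNP : xK => [i /negP xi]; exists i; rewrite ?mem_index_enum//=.
  apply/eqP/bump_eq0; apply: contra xi; rewrite !in_itv/= => /andP[-> /le_trans]; apply.
  by rewrite lerD2l.
have sK := supp_subset (@closed_cbox R d a (fun i => b i + e)) phi0.
have cs : compact (supp phi).
  by apply: subclosed_compact (@compact_cbox R d _ _) sK; exact: closed_closure.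
split => //; last exact: subset_trans KO.
by apply: smooth_tensor => i; exact: smooth1_bump.
Qed.

Lemma cvg_tensor_bump a b x :
  tensor (fun i => bump (a i) (b i) m) x @[m --> \oo] --> (\1_(box a b) x : R).
Proof.
have -> : \1_(box a b) x = \prod_i (\1_(`]a i, b i]%classic) (x ord0 i) : R).
  rewrite indicE; case: (boolP (x \in _)) => [/set_mem xab|/negP xab].
    by rewrite big1// => i _; rewrite indicE mem_set//; exact: xab.
  apply/esym/eqP; rewrite prodf_seq_eq0; apply/hasP.
  have /existsNP[i xi] : ~ box a b x by move=> H; apply: xab; rewrite inE.
  by exists i; rewrite ?mem_index_enum//= indicE memNset.
rewrite /tensor; elim: (index_enum _) => [|i s IH].
  by under eq_fun do rewrite big_nil; rewrite big_nil; exact: cvg_cst.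
under eq_fun do rewrite big_cons; rewrite big_cons.
by apply: cvgM => //; exact: cvg_bump.
Qed.

Lemma tensor_bump_le1 a b m x : `|tensor (fun i => bump (a i) (b i) m) x| <= 1.
Proof.
rewrite normr_prod; apply: prodr_ile1 => i _.
by rewrite normr_ge0 ger0_norm ?bump_ge0// bump_le1.
Qed.

Variables (Omega : set 'rV[R]_d) (g : 'rV[R]_d -> R).
Hypotheses (oO : open Omega) (ig : mu.-integrable Omega (EFin \o g)).
Hypothesis g_test : forall phi, test_fun Omega phi ->
  \int[mu]_(x in Omega) (g x * phi x) = 0.

Let mO : measurable Omega. Proof. exact: open_measurable_rV. Qed.

Let mg : measurable_fun Omega g.
Proof. by apply/measurable_EFinP; exact: measurable_int ig. Qed.

Lemma box_subset a b (e : R) : 0 < e -> cbox a (fun i => b i + e) `<=` Omega ->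
  box a b `<=` Omega.
Proof.
move=> e0 KO x xab; apply: KO => i; have := xab i.
by rewrite !in_itv/= => /andP[/ltW -> /=] /le_trans; apply; rewrite lerDl ltW.
Qed.

Lemma orthogonal_box_integral a b (e : R) : 0 < e -> cbox a (fun i => b i + e) `<=` Omega ->
  (\int[mu]_(x in box a b) (g x)%:E = 0)%E.
Proof.
move=> e0 KO.
have bO := box_subset e0 KO.
pose N := Num.truncn e^-1.
pose phi k := tensor (fun i => bump (a i) (b i) (k + N)%N).
have tphi k : test_fun Omega (phi k).
  apply: (@test_fun_bump _ _ _ e) KO.
  rewrite invf_ple ?posrE// (le_trans (ltW (truncnS_gt _)))// ler_nat.
  by rewrite ltnS leq_addl.
have mphi k : measurable_fun Omega (phi k).
  apply: measurable_funTS; apply: continuous_measurable_rV.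
  by have [/(_ [::])[]] := tphi k.
have iphi k : mu.-integrable Omega (EFin \o (fun x => g x * phi k x)).
  apply: le_integrable ig => //.
    by apply/measurable_EFinP; exact: measurable_funM.
  move=> x Ox /=; rewrite lee_fin normrM -[leRHS]mulr1 ler_wpM2l//.
  exact: tensor_bump_le1.
have [] := @dominated_convergence _ _ _ mu Omega mO (fun k x => (g x * phi k x)%:E)
  (fun x => (g x * \1_(box a b) x)%:E) (fun x => `|(g x)%:E|)%E.
- by move=> k; exact: measurable_int (iphi k).
- apply/measurable_EFinP; apply: measurable_funM => //; apply: measurable_indic.
  exact: measurable_box.
- apply: aeW => x Ox; apply/cvg_EFin; first exact: nearW.
  apply: cvgM; first exact: cvg_cst.
  by have := @cvg_tensor_bump a b x; rewrite -(cvg_shiftn N).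
- exact: integrable_abse.
- apply: aeW => x k Ox; rewrite lee_fin normrM -[leRHS]mulr1 ler_wpM2l//.
  exact: tensor_bump_le1.
move=> _ _; rewrite (_ : (fun k => _) = cst 0%E); last first.
  apply/funext => k /=; rewrite -[LHS]fineK; last exact: integrable_fin_num (iphi k).
  by rewrite -/(Rintegral mu Omega (fun x => g x * phi k x)) g_test.
move=> /(cvg_lim (@ereal_hausdorff R)); rewrite lim_cst// => I0.
rewrite [RHS]I0.
rewrite -[in LHS](setIidr bO) integral_mkcondr; apply: eq_integral => x _.
by rewrite patchE indicE; case: ifP; rewrite ?mulr1 ?mulr0.
Qed.

Lemma orthogonal_ae_eq0_box a b (e : R) : 0 < e -> cbox a (fun i => b i + e) `<=` Omega ->
  ae_eq mu (box a b) (EFin \o g) (cst 0%E).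
Proof.
move=> e0 KO.
have bO := box_subset e0 KO.
have mb := @measurable_box R d a b.
have ib : mu.-integrable (box a b) (EFin \o g) by apply: integrableS ig.
apply: integral_ae_eq => // E Eb mE; rewrite integral0.
have : <<s boxes >> E by rewrite -measurable_rVE.
move: E {mE} Eb => E Eb sE; rewrite -(setIidr Eb); move: E sE {Eb}.
apply: (dynkin_induction measurable_rVE setI_closed_boxes).
- by rewrite setIT (orthogonal_box_integral e0 KO).
- move=> _ [[a' b'] _ <-]; rewrite setI_box; apply: (@orthogonal_box_integral _ _ e e0).
  move=> x xK; apply: KO => i; have := xK i; rewrite !in_itv/= ge_max => /andP[/andP[-> _]] /=.
  by move=> /le_trans; apply; rewrite lerD2r ge_min lexx.
- move=> S mS S0; rewrite -setDE.
  have := @integral_setU _ _ _ mu (box a b `&` S) (box a b `\` S) (EFin \o g).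
  rewrite setUIDK S0 add0e -(orthogonal_box_integral e0 KO) => -> //.
  + exact: measurableI.
  + exact: measurableD.
  + exact: measurable_int ib.
  + apply/disj_set2P; apply/seteqP; split => // x [[_ Sx] [_]]; exact.
- move=> F mF tF F0; rewrite setI_bigcupr integral_bigcup.
  + by rewrite eseries0// => k _ _; exact: F0.
  + exact: trivIset_setIl.
  + by move=> k; exact: measurableI.
  + rewrite -setI_bigcupr; apply: integrableS ib => //.
    by apply: measurableI => //; exact: bigcup_measurable.
Qed.

Lemma orthogonal_ae_eq0 : {ae mu, forall x, Omega x -> g x = 0}.
Proof.
have [I [a [b [e [e0 OE KO]]]]] := open_box_cover oO.
pose F n : set 'rV[R]_d := if unpickle n is Some k then
  ~` [set x | box (a k) (b k) x -> g x = 0] else set0.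
apply: (@negligibleS _ _ _ mu (\bigcup_n F n)); last first.
  apply: negligible_bigcup => n; rewrite /F; case: unpickle => [k|]; last exact: negligible_set0.
  apply: negligibleS (orthogonal_ae_eq0_box (e0 k) (KO k)).
  apply: subsetC => x /= H /H; by case.
move=> x /= /not_implyP[Ox gx]; move: (Ox); rewrite OE => -[k _ xk].
by exists (pickle k) => //; rewrite /F pickleK => /(_ xk).
Qed.

End fundamental_lemma.

(** * Completeness of L^2 *)

Lemma limn_einf_ge {R : realType} (u : (\bar R)^nat) (c : \bar R) :
  (forall n, c <= u n)%E -> (c <= limn_einf u)%E.
Proof.
move=> cu; rewrite limn_einf_lim; apply: lime_ge; first exact: is_cvg_einfs.
by apply: nearW => n; apply: le_ereal_inf_tmp => _ [m /= _ <-].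
Qed.

Lemma limn_einf_le {R : realType} (u : (\bar R)^nat) (c : \bar R) :
  (forall n, u n <= c)%E -> (limn_einf u <= c)%E.
Proof.
move=> uc; rewrite limn_einf_lim; apply: lime_le; first exact: is_cvg_einfs.
apply: nearW => n; apply: le_trans (uc n); apply: ereal_inf_lbound.
by exists n => /=.
Qed.

Section L2_scalar.
Context {R : realType} {d : nat}.
Local Notation mu := (@lebesgue_rV R d).
Local Notation scalar_field := ('rV[R]_d -> R^o).
Variable D : set 'rV[R]_d.
Hypothesis mD : measurable D.
Implicit Types p q g : scalar_field.

Definition dot p q : R := \int[mu]_(x in D) (p x * q x).

Lemma L2_mul_integrable p q : L2 D p -> L2 D q ->
  mu.-integrable D (EFin \o (fun x => p x * q x)).
Proof.
move=> [mp ip] [mq iq]; apply: (le_integrable mD _ _ (integrableD mD ip iq)).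
  by apply/measurable_EFinP; exact: measurable_funM.
move=> x Dx /=; rewrite lee_fin (ger0_norm (addr_ge0 (sqr_ge0 _) (sqr_ge0 _))).
rewrite normrM -(real_normK (num_real (p x))) -(real_normK (num_real (q x))).
have := sqr_ge0 (`|p x| - `|q x|); have := normr_ge0 (p x); have := normr_ge0 (q x); nra.
Qed.

Lemma subspace_L2 : subspace (L2 D : set scalar_field).
Proof.
split.
- split; first exact: measurable_cst.
  by apply: (eq_integrable mD (cst 0%E)) => [x _|]; [rewrite expr0n|exact: integrable0].
- move=> p q pL qL; case: (pL) (qL) => mp ip [mq iq]; split; first exact: measurable_funD.
  have := integrableD mD (integrableD mD ip iq) (integrableZl mD 2 (L2_mul_integrable pL qL)).
  by apply: eq_integrable => // x _ /=; rewrite -EFinM -!EFinD; congr EFin; rewrite -[(p + q) x]/(p x + q x); ring.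
- move=> a p [mp ip]; split; first exact: (measurable_funM (measurable_cst a) mp).
  have := integrableZl mD (a ^+ 2) ip.
  by apply: eq_integrable => // x _ /=; rewrite -EFinM -exprMn.
Qed.

Lemma dotC p q : dot p q = dot q p.
Proof. by apply: eq_Rintegral => x _; rewrite mulrC. Qed.

Lemma semi_inner_dot : semi_inner (L2 D : set scalar_field) dot.
Proof.
split; [exact: subspace_L2|exact: dotC| | |].
- move=> p q g pL qL gL; rewrite /dot -RintegralD; [|exact: mD|exact: L2_mul_integrable|exact: L2_mul_integrable].
  by apply: eq_Rintegral => x _; rewrite -mulrDl.
- move=> a p g pL gL; rewrite /dot -RintegralZl; [|exact: mD|exact: L2_mul_integrable].
  by apply: eq_Rintegral => x _; rewrite mulrA.
- by move=> p pL; apply: Rintegral_ge0 => x _; rewrite -expr2 sqr_ge0.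
Qed.

Lemma ae_eq_dot p p' q : L2 D p -> L2 D p' -> L2 D q ->
  {ae mu, forall x, D x -> p x = p' x} -> dot p q = dot p' q.
Proof.
move=> pL pL' qL pp'; congr fine; apply: ae_eq_integral => //.
- exact: measurable_int (L2_mul_integrable pL qL).
- exact: measurable_int (L2_mul_integrable pL' qL).
- by apply: filterS pp' => x /= pp' Dx; rewrite pp'.
Qed.

Hypothesis Doo : (mu D < +oo)%E.

Lemma bounded_L2 p (C : R) : measurable_fun D p -> (forall x, D x -> `|p x| <= C) -> L2 D p.
Proof.
move=> mp pC; split => //; apply: (@bounded_integrable _ _ _ _ (C ^+ 2)) => //.
  exact: measurable_funX.
by move=> x Dx; rewrite normrX ler_sqr ?nnegrE ?pC// (le_trans _ (pC _ Dx)).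
Qed.

Lemma L2_cst (c : R) : L2 D (cst c).
Proof. by apply: (@bounded_L2 _ `|c|) => //; exact: measurable_cst. Qed.

Lemma L2_integrable p : L2 D p -> mu.-integrable D (EFin \o p).
Proof.
move=> pL; apply: eq_integrable (L2_mul_integrable pL (L2_cst 1)) => // x _ /=.
by rewrite mulr1.
Qed.

Lemma seminorm_dot1 p : L2 D p ->
  \int[mu]_(x in D) `|p x| <= seminorm dot (cst 1) * seminorm dot p.
Proof.
move=> pL; have npL : L2 D (fun x => `|p x|).
  case: pL => mp ip; split; first exact: measurableT_comp.
  by apply: eq_integrable ip => // x _ /=; rewrite real_normK ?num_real.
have -> : seminorm dot p = seminorm dot (fun x => `|p x|).
  by congr Num.sqrt; apply: eq_Rintegral => x _; rewrite -!expr2 real_normK ?num_real.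
apply: le_trans (CauchySchwarz semi_inner_dot (L2_cst 1) npL).
apply: le_trans (ler_norm _); rewrite le_eqVlt; apply/orP; left; apply/eqP.
by apply: eq_Rintegral => x _; rewrite mul1r.
Qed.

Lemma fast_ae_cvg (p_ : nat -> scalar_field) : (forall k, L2 D (p_ k)) ->
  (forall k, seminorm dot (p_ k.+1 - p_ k) <= 2^-1 ^+ k) ->
  {ae mu, forall x, D x -> cvgn (p_ ^~ x)}.
Proof.
move=> pL pC; have [L0 LD LZ] := subspace_L2.
pose g k x : R := `|p_ k.+1 x - p_ k x|.
have dL k : L2 D (p_ k.+1 - p_ k) by exact: (subspaceB subspace_L2).
have g0 k x : 0 <= g k x by exact: normr_ge0.
have mg k : measurable_fun D (g k) by apply: measurableT_comp => //; case: (dL k).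
have ig k : mu.-integrable D (EFin \o g k).
  by apply: eq_integrable (integrable_norm (L2_integrable (dL k))).
pose c : R := seminorm dot (cst 1).
have sumg : (\int[mu]_(x in D) (\sum_(k <oo) (g k x)%:E) < +oo)%E.
  rewrite integral_nneseries//=; last 2 first.
  - by move=> k; apply/measurable_EFinP; exact: mg.
  - by move=> k x Dx; rewrite lee_fin g0.
  apply: (@le_lt_trans _ _ (\sum_(k <oo) (c * 2^-1 ^+ k)%:E)%E).
    apply: lee_nneseries => k _; first by move=> _; apply: integral_ge0 => x _; rewrite lee_fin g0.
    rewrite -[X in (X <= _)%E]fineK; last exact: (integrable_fin_num mD (ig k)).
    rewrite lee_fin -/(Rintegral mu D (g k)); apply: le_trans (seminorm_dot1 (dL k)) _.
    by rewrite ler_wpM2l// seminorm_ge0.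
  rewrite (_ : (fun n => _) = EFin \o series (geometric c 2^-1)); last first.
    by apply/funext => n /=; rewrite /series/= -sumEFin.
  have H : (EFin \o series (geometric c 2^-1)) n @[n --> \oo] --> (c / (1 - 2^-1))%:E.
    apply: cvg_EFin; first exact: nearW.
    by apply: cvg_geometric_series; rewrite ger0_norm; lra.
  by rewrite (cvg_lim (@ereal_hausdorff R) H) ltry.
have ig' : mu.-integrable D (fun x => \sum_(k <oo) (g k x)%:E)%E.
  have ge0 x : (0 <= \sum_(k <oo) (g k x)%:E)%E by apply: nneseries_ge0 => k _ _; rewrite lee_fin g0.
  apply/integrableP; split.
    apply: ge0_emeasurable_sum => // [k x Dx _|k _]; first by rewrite lee_fin g0.
    apply/measurable_EFinP; exact: mg.
  by under eq_integral => x _ do rewrite gee0_abs//.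
apply: filterS (integrable_ae mD ig') => x /= H Dx; have {}H := H Dx.
have : cvgn [normed series (telescope (p_ ^~ x))].
  apply: nondecreasing_is_cvgn.
    by apply/nondecreasing_series => k _ _; exact: normr_ge0.
  exists (fine (\sum_(k <oo) (g k x)%:E)) => _ [n _ <-].
  rewrite -lee_fin fineK// /series/= -sumEFin.
  by apply: nneseries_lim_ge => k _ _; rewrite lee_fin g0.
move=> /normed_cvg ct; rewrite (_ : p_ ^~ x = (fun n => p_ 0 x + series (telescope (p_ ^~ x)) n)).
  by apply: is_cvgD => //; exact: is_cvg_cst.
by apply/funext => n; exact: eq_sum_telescope.
Qed.

Lemma fast_cauchy (p_ : nat -> scalar_field) k m : (forall k, L2 D (p_ k)) ->
  (forall k, seminorm dot (p_ k.+1 - p_ k) <= 2^-1 ^+ k) ->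
  seminorm dot (p_ (k + m)%N - p_ k) <= 2 * 2^-1 ^+ k.
Proof.
move=> pL pC; have B x y := subspaceB subspace_L2 (x := x) (y := y).
suff : seminorm dot (p_ (k + m)%N - p_ k) <= 2 * 2^-1 ^+ k - 2 * 2^-1 ^+ (k + m).
  have : (0 : R) <= 2^-1 ^+ (k + m) by rewrite exprn_ge0.
  by lra.
elim: m => [|m IH].
  by rewrite addn0 !subrr /seminorm /dot; under eq_Rintegral do rewrite mul0r; rewrite Rintegral_cst// mul0r sqrtr0.
have -> : p_ (k + m.+1)%N - p_ k = (p_ (k + m).+1 - p_ (k + m)%N) + (p_ (k + m)%N - p_ k).
  by rewrite addnS addrA subrK.
apply: le_trans (ler_seminormD semi_inner_dot _ _) _; [exact: B|exact: B|].
have := pC (k + m)%N; rewrite addnS exprS; lra.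
Qed.

Lemma L2_fast_complete : fast_complete dot (L2 D).
Proof.
move=> p_ pL pC; have B x y := subspaceB subspace_L2 (x := x) (y := y).
pose p x : R := fine (limn_esup (fun n => (p_ n x)%:E)).
have mp_ k : measurable_fun D (p_ k) by case: (pL k).
have mp : measurable_fun D p.
  apply: (measurableT_comp (fine_measurable measurableT)) => //.
  apply: measurable_fun_limn_esup => k; exact/measurable_EFinP.
have p_p : {ae mu, forall x, D x -> p_ ^~ x @ \oo --> p x}.
  apply: filterS (fast_ae_cvg pL pC) => x H Dx; have /cvg_ex[l pl] := H Dx.
  rewrite /p (_ : limn_esup _ = l%:E)//.
  have pl' : (p_ n x)%:E @[n --> \oo] --> l%:E by apply/cvg_EFin => //; exact: nearW.
  by have [_] := cvg_limn_einf_sup pl'.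
have key k : (\int[mu]_(x in D) ((p_ k x - p x) ^+ 2)%:E <= ((2 * 2^-1 ^+ k) ^+ 2)%:E)%E.
  pose f m x := ((p_ k x - p_ (k + m)%N x) ^+ 2)%:E : \bar R.
  have mf m : measurable_fun D (f m).
    by apply/measurable_EFinP; apply: measurable_funX; exact: measurable_funB.
  have f0 m x : D x -> (0 <= f m x)%E by move=> _; rewrite lee_fin sqr_ge0.
  apply: (@le_trans _ _ (\int[mu]_(x in D) limn_einf (f^~ x))%E).
    apply: ae_ge0_le_integral => //.
    + by move=> x _; rewrite lee_fin sqr_ge0.
    + by apply/measurable_EFinP; apply: measurable_funX; exact: measurable_funB.
    + by move=> x Dx; apply: limn_einf_ge => m; exact: f0.
    + rewrite (_ : (fun x => _) = \- (fun x => limn_esup (fun m => - f m x)%E))%E; last first.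
        apply/funext => x /=; rewrite -limn_einfN; congr limn_einf.
        by apply/funext => m /=; rewrite opprK.
      apply: measurableT_comp => //; apply: measurable_fun_limn_esup => m.
      exact: measurableT_comp.
    + apply: filterS p_p => x H Dx; have {}H := H Dx.
      have cf : f m x @[m --> \oo] --> ((p_ k x - p x) ^+ 2)%:E.
        apply/cvg_EFin; first exact: nearW.
        have : p_ (k + m)%N x @[m --> \oo] --> p x.
          by under eq_fun do rewrite addnC; rewrite -(cvg_shiftn k) in H.
        by move=> H'; apply: (@cvgM _ _ _ _ (fun m => p_ k x - p_ (k + m)%N x)); apply: cvgB => //; exact: cvg_cst.
      by have [<- _] := cvg_limn_einf_sup cf.
  apply: le_trans (fatou mu mD mf f0) _.
  apply: limn_einf_le => m.
  have pkL : L2 D (p_ (k + m)%N - p_ k) by exact: B.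
  have fE x : f m x = ((p_ (k + m)%N - p_ k) x ^+ 2)%:E by rewrite /f -sqrrN opprB.
  under eq_integral do rewrite fE.
  rewrite -[X in (X <= _)%E]fineK; last by apply: integrable_fin_num => //; case: pkL.
  rewrite lee_fin.
  have -> : fine (\int[mu]_(x in D) ((p_ (k + m)%N - p_ k) x ^+ 2)%:E)%E =
      seminorm dot (p_ (k + m)%N - p_ k) ^+ 2 by rewrite (sqr_seminorm semi_inner_dot).
  by rewrite ler_sqr ?nnegrE ?seminorm_ge0 ?mulr_ge0 ?exprn_ge0//; exact: fast_cauchy.
have dL k : L2 D (p_ k - p).
  split; first exact: measurable_funB.
  apply/integrableP; split.
    by apply/measurable_EFinP; apply: measurable_funX; exact: measurable_funB.
  under eq_integral do rewrite gee0_abs ?lee_fin ?sqr_ge0//.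
  by apply: le_lt_trans (key k) _; rewrite ltry.
have nk k : seminorm dot (p_ k - p) <= 2 * 2^-1 ^+ k.
  rewrite -ler_sqr ?nnegrE ?seminorm_ge0 ?mulr_ge0 ?exprn_ge0//.
  rewrite (sqr_seminorm semi_inner_dot (dL k)) -lee_fin fineK; first exact: key.
  by apply: integrable_fin_num => //; case: (dL k).
exists p.
  by rewrite -(subKr (p_ 0) p); exact: B.
apply: (@squeeze_cvgr _ _ _ _ (cst 0) (fun k => 2 * 2^-1 ^+ k)).
- by apply: nearW => k; rewrite seminorm_ge0 nk.
- exact: cvg_cst.
- rewrite -[X in _ --> X](mulr0 2); apply: cvgM; first exact: cvg_cst.
  by apply: cvg_expr; rewrite ger0_norm; lra.
Qed.

End L2_scalar.

(** * Test functions and weak derivatives *)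

Section test_functions.
Context {R : realType} {d : nat}.
Local Notation mu := (@lebesgue_rV R d).
Local Notation scalar_field := ('rV[R]_d -> R^o).
Implicit Types (Omega D : set 'rV[R]_d) (phi psi p q g : scalar_field) (j : 'I_d).

Lemma test_fun_continuous Omega phi : test_fun Omega phi -> continuous phi.
Proof. by move=> [/(_ [::])[]]. Qed.

Lemma test_fun_partial_continuous Omega phi j : test_fun Omega phi -> continuous (partial j phi).
Proof. by move=> [/(_ [:: j])[]]. Qed.

Lemma test_fun_is_derive Omega phi j x : test_fun Omega phi ->
  is_derive x (delta_mx ord0 j) phi (partial j phi x).
Proof. by move=> [/(_ [::])[_ H] _ _]; apply: derivableP; exact: H. Qed.

Lemma notin_supp phi x : ~ supp phi x -> phi x = 0.
Proof. by move=> sx; apply/eqP/negPn/negP => px; apply: sx; exact: subset_closure. Qed.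

Lemma notin_supp_partial phi j x : ~ supp phi x -> partial j phi x = 0.
Proof.
move=> sx; rewrite /partial (@near_eq_derive _ _ _ _ (cst 0)) ?derive_cst//.
have : nbhs x (~` supp phi).
  by apply: open_nbhs_nbhs; split => //; apply: closed_openC; exact: closed_closure.
by apply: filterS => y /notin_supp.
Qed.

Lemma test_fun_notin Omega phi x : test_fun Omega phi -> ~ Omega x -> phi x = 0.
Proof. by move=> [_ _ sO] Ox; apply: notin_supp => /sO. Qed.

Lemma test_fun_partial_notin Omega phi j x : test_fun Omega phi -> ~ Omega x ->
  partial j phi x = 0.
Proof. by move=> [_ _ sO] Ox; apply: notin_supp_partial => /sO. Qed.

Lemma test_funS Omega Omega' phi : Omega `<=` Omega' -> test_fun Omega phi -> test_fun Omega' phi.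
Proof. by move=> OO' [? ? sO]; split => //; exact: subset_trans OO'. Qed.

Lemma test_fun_cbox Omega phi : test_fun Omega phi ->
  exists M : R, supp phi `<=` cbox (fun=> - M) (fun=> M).
Proof.
move=> [_ /(@compact_bounded R 'rV[R]_d)/bounded_set_box[n Hn] _]; exists n%:R => x /Hn xn i.
by have := xn i; rewrite !in_itv/= => /andP[/ltW -> ->].
Qed.

Lemma test_fun_L2 Omega phi D : measurable D -> (mu D < +oo)%E ->
  test_fun Omega phi -> L2 D phi.
Proof.
move=> mD Doo tphi; case: (tphi) => _ cs _.
have [C HC] := continuous_compact_bounded (test_fun_continuous tphi) cs.
apply: (@bounded_L2 _ _ _ mD Doo _ `|C|).
  by apply: measurable_funTS; apply: continuous_measurable_rV; exact: test_fun_continuous tphi.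
move=> x _; have [/HC H|/notin_supp ->] := pselect (supp phi x); last by rewrite normr0.
exact: le_trans H (ler_norm _).
Qed.

Lemma test_fun_partial_L2 Omega phi j D : measurable D -> (mu D < +oo)%E ->
  test_fun Omega phi -> L2 D (partial j phi).
Proof.
move=> mD Doo tphi; case: (tphi) => _ cs _.
have [C HC] := continuous_compact_bounded (test_fun_partial_continuous (j := j) tphi) cs.
apply: (@bounded_L2 _ _ _ mD Doo _ `|C|).
  by apply: measurable_funTS; apply: continuous_measurable_rV; exact: test_fun_partial_continuous tphi.
move=> x _; have [/HC H|/notin_supp_partial ->] := pselect (supp phi x); last by rewrite normr0.
exact: le_trans H (ler_norm _).
Qed.

Lemma iter_partialD s phi psi : smooth phi -> smooth psi ->
  iter_partial s (phi + psi) = iter_partial s phi + iter_partial s psi.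
Proof.
move=> sp sq; elim: s => [//|j s IH] /=; rewrite IH; apply/funext => x.
by rewrite /partial deriveD//; [exact: (sp s).2|exact: (sq s).2].
Qed.

Lemma iter_partialZ s (a : R) phi : smooth phi ->
  iter_partial s (a *: phi) = a *: iter_partial s phi.
Proof.
move=> sp; elim: s => [//|j s IH] /=; rewrite IH; apply/funext => x.
by rewrite /partial deriveZ//; exact: (sp s).2.
Qed.

Lemma test_fun_scaleD Omega (a : R) phi psi : test_fun Omega phi -> test_fun Omega psi ->
  test_fun Omega (a *: phi + psi).
Proof.
move=> [sp cp pO] [sq cq qO].
have sap : smooth (a *: phi).
  move=> s; rewrite iter_partialZ//; split => [x|j x].
    by apply: (@continuousZr _ _ _ (iter_partial s phi)); exact: (sp s).1.
  by apply: derivableZ; exact: (sp s).2.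
have cK : compact (supp phi `|` supp psi) by exact: compactU.
have clK : closed (supp phi `|` supp psi) by apply: closedU; exact: closed_closure.
have sK : supp (a *: phi + psi) `<=` supp phi `|` supp psi.
  apply: supp_subset => // x /not_orP[xp xq].
  rewrite -[LHS]/(a * phi x + psi x).
  by rewrite (notin_supp xp) (notin_supp xq) mulr0 add0r.
split.
- move=> s; rewrite iter_partialD//; split => [x|j x].
    by apply: continuousD; [exact: (sap s).1|exact: (sq s).1].
  by apply: derivableD; [exact: (sap s).2|exact: (sq s).2].
- by apply: subclosed_compact cK sK; exact: closed_closure.
- by move=> x /sK [/pO|/qO].
Qed.

Lemma smooth0 : smooth (0 : scalar_field).
Proof.
have E s : iter_partial s (0 : scalar_field) = 0.
  by elim: s => // j s /= ->; apply/funext => x; rewrite -[0]/(cst (0 : R^o)) /partial derive_cst.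
move=> s; rewrite E -[0]/(cst (0 : R^o)); split => [|j x]; first exact: cst_continuous.
exact: derivable_cst.
Qed.

Lemma test_fun0 Omega : test_fun Omega (0 : scalar_field).
Proof.
have s0 : supp (0 : scalar_field) `<=` set0.
  by apply: supp_subset => //; exact: closed0.
have E : supp (0 : scalar_field) = set0 by apply/seteqP; split.
by split; [exact: smooth0|rewrite E; exact: compact0|rewrite E].
Qed.

Lemma subspace_test_fun Omega : subspace (test_fun Omega : set scalar_field).
Proof.
split; first exact: test_fun0.
- by move=> p q tp tq; rewrite -[p]scale1r; exact: test_fun_scaleD.
- by move=> a p tp; rewrite -[_ *: _]addr0; apply: test_fun_scaleD => //; exact: test_fun0.
Qed.

Lemma partial_mul_integral Omega Omega' phi psi j :
  test_fun Omega phi -> test_fun Omega' psi ->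
  \int[mu]_x (phi x * partial j psi x + psi x * partial j phi x) = 0.
Proof.
move=> tp tq; have [M HM] := test_fun_cbox tp.
have cp := test_fun_continuous tp; have cq := test_fun_continuous tq.
have cdp := test_fun_partial_continuous (j := j) tp; have cdq := test_fun_partial_continuous (j := j) tq.
apply: (@integral_partial_eq0 _ _ (fun x => phi x * psi x) _ j M).
- by move=> x; apply: cvgM; [exact: (@nbhs_filter 'rV[R]_d x)|exact: cp|exact: cq].
- move=> x; apply: cvgD; first exact: (@nbhs_filter 'rV[R]_d x).
    by apply: cvgM; [exact: (@nbhs_filter 'rV[R]_d x)|exact: cp|exact: cdq].
  by apply: cvgM; [exact: (@nbhs_filter 'rV[R]_d x)|exact: cq|exact: cdp].
- by move=> x; apply: is_deriveM; [exact: (test_fun_is_derive j x tp)|exact: (test_fun_is_derive j x tq)].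
- by move=> x xM; rewrite (@notin_supp phi) ?mul0r// => /HM.
- move=> x xM; have sx : ~ supp phi x by move/HM.
  by rewrite (notin_supp sx) (notin_supp_partial _ sx) mul0r mulr0 addr0.
Qed.

End test_functions.

Section weak_partial.
Context {R : realType} {d : nat}.
Local Notation mu := (@lebesgue_rV R d).
Local Notation scalar_field := ('rV[R]_d -> R^o).
Variable Omega : set 'rV[R]_d.
Hypotheses (oO : open Omega) (Ooo : (mu Omega < +oo)%E).
Implicit Types (phi psi p q g h : scalar_field) (j : 'I_d).

Let mO : measurable Omega. Proof. exact: open_measurable_rV. Qed.
Let siO := semi_inner_dot mO.
Let tL phi : test_fun Omega phi -> L2 Omega phi. Proof. exact: test_fun_L2. Qed.
Let dtL phi j : test_fun Omega phi -> L2 Omega (partial j phi). Proof. exact: test_fun_partial_L2. Qed.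

Lemma is_weak_partialE j p g : is_weak_partial Omega j p g <->
  forall phi, test_fun Omega phi -> dot Omega p (partial j phi) = - dot Omega g phi.
Proof. by []. Qed.

Lemma is_weak_partial_scaleD j (a : R) p q g h : L2 Omega p -> L2 Omega q -> L2 Omega g -> L2 Omega h ->
  is_weak_partial Omega j p g -> is_weak_partial Omega j q h ->
  is_weak_partial Omega j (a *: p + q) (a *: g + h).
Proof.
move=> pL qL gL hL pg qh; apply/is_weak_partialE => phi tphi.
have [_ LD LZ] := subspace_L2 mO.
have [apL agL] := (LZ a _ pL, LZ a _ gL).
have [L1 L2] := (tL tphi, dtL j tphi).
rewrite !(siDl siO)// !(siZl siO)// [dot _ p _](pg _ tphi) [dot _ q _](qh _ tphi).
by rewrite opprD mulrN.
Qed.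

Lemma is_weak_partial_unique j p g h : L2 Omega g -> L2 Omega h ->
  is_weak_partial Omega j p g -> is_weak_partial Omega j p h ->
  {ae mu, forall x, Omega x -> g x = h x}.
Proof.
move=> gL hL pg ph.
have ghL : L2 Omega (g - h) by exact: (subspaceB (subspace_L2 mO)).
have : {ae mu, forall x, Omega x -> (g - h) x = 0}.
  apply: orthogonal_ae_eq0 => //; first exact: L2_integrable.
  move=> phi tphi; rewrite -[LHS]/(dot Omega (g - h) phi) (siBl siO)//; last exact: tL.
  have := pg _ tphi; rewrite (ph _ tphi) => /eqP; rewrite eqr_opp => /eqP H.
  by apply/eqP; rewrite subr_eq0; apply/eqP.
by apply: filterS => x H Ox; apply/eqP; rewrite -subr_eq0; apply/eqP; exact: H.
Qed.

Lemma weak_partialP j p : (exists g, L2 Omega g /\ is_weak_partial Omega j p g) ->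
  L2 Omega (weak_partial Omega j p) /\ is_weak_partial Omega j p (weak_partial Omega j p).
Proof. exact: (@getPex _ [set g | L2 Omega g /\ is_weak_partial Omega j p g]). Qed.

Lemma test_fun_weak_partial Omega' j phi : Omega' `<=` Omega -> test_fun Omega' phi ->
  is_weak_partial Omega j phi (partial j phi).
Proof.
move=> OO' tp' psi tq; have tp := test_funS OO' tp'.
apply/eqP; rewrite -subr_eq0 opprK; apply/eqP.
rewrite -RintegralD//; last 2 first.
- by apply: L2_mul_integrable => //; [exact: tL|exact: dtL].
- by apply: L2_mul_integrable => //; [exact: dtL|exact: tL].
rewrite Rintegral_setT; last first.
  by move=> x Ox; rewrite (test_fun_notin tp Ox) (test_fun_notin tq Ox) mul0r mulr0 addr0.
rewrite -(partial_mul_integral j tp tq); apply: eq_Rintegral => x _.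
by rewrite (mulrC (partial j phi x)).
Qed.

Lemma is_weak_partial_closed j (p_ g_ : nat -> scalar_field) p g :
  (forall k, L2 Omega (p_ k)) -> (forall k, L2 Omega (g_ k)) -> L2 Omega p -> L2 Omega g ->
  (forall k, is_weak_partial Omega j (p_ k) (g_ k)) ->
  seminorm (dot Omega) (p_ k - p) @[k --> \oo] --> (0 : R) ->
  seminorm (dot Omega) (g_ k - g) @[k --> \oo] --> (0 : R) ->
  is_weak_partial Omega j p g.
Proof.
move=> p_L g_L pL gL wp cp cg phi tphi.
have c1 := cvg_semi_inner siO p_L pL (dtL j tphi) cp.
have c2 := cvg_semi_inner siO g_L gL (tL tphi) cg.
have c3 : dot Omega (p_ k) (partial j phi) @[k --> \oo] --> - dot Omega g phi.
  rewrite (_ : (fun k => _) = (fun k => - dot Omega (g_ k) phi)); first exact: cvgN.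
  by apply/funext => k; exact: wp.
exact: (cvg_unique _ c1 c3).
Qed.

End weak_partial.

(** * Vector fields and H^1 *)

Lemma cvg_sum_ord {R : realType} d (f : 'I_d -> nat -> R) (l : 'I_d -> R) :
  (forall i, f i k @[k --> \oo] --> l i) ->
  \sum_i f i k @[k --> \oo] --> \sum_i l i.
Proof.
move=> fl; elim: (index_enum _) => [|i s IH].
  by under eq_fun do rewrite big_nil; rewrite big_nil; exact: cvg_cst.
under eq_fun do rewrite big_cons; rewrite big_cons.
exact: cvgD.
Qed.

Section vector_fields.
Context {R : realType} {d : nat}.
Local Notation mu := (@lebesgue_rV R d).
Local Notation vector_field := ('rV[R]_d -> 'rV[R]_d).
Local Notation scalar_field := ('rV[R]_d -> R^o).
Implicit Types (D : set 'rV[R]_d) (u v w : vector_field) (p : scalar_field) (i j : 'I_d).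

Lemma coord_scaleD i (a : R) u v :
  (coord i (a *: u + v) : scalar_field) = a *: (coord i u : scalar_field) + coord i v.
Proof. by apply/funext => x; rewrite /coord !mxE. Qed.

Lemma coordB i u v : (coord i (u - v) : scalar_field) = (coord i u : scalar_field) - coord i v.
Proof. by apply/funext => x; rewrite /coord !mxE. Qed.

Lemma coord_zero i : (coord i (0 : vector_field) : scalar_field) = 0.
Proof. by apply/funext => x; rewrite /coord !mxE. Qed.

Lemma subspace_coord (S : set scalar_field) : subspace S ->
  subspace [set u : vector_field | forall i, S (coord i u)].
Proof.
move=> [S0 SD SZ]; split=> [i|u v Su Sv i|a u Su i]; first by rewrite coord_zero.
- by rewrite -[u]scale1r coord_scaleD scale1r; exact: SD.
- by rewrite -[_ *: u]addr0 coord_scaleD coord_zero addr0; exact: SZ.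
Qed.

Section L2_vector.
Variable D : set 'rV[R]_d.
Hypotheses (mD : measurable D) (Doo : (mu D < +oo)%E).
Let siD := semi_inner_dot mD.

Lemma subspace_L2_field : subspace (L2_field D).
Proof. exact: (subspace_coord (subspace_L2 mD)). Qed.

Lemma Rintegral_sum (s : seq 'I_d) (f : 'I_d -> 'rV[R]_d -> R) :
  (forall i, mu.-integrable D (EFin \o f i)) ->
  mu.-integrable D (EFin \o (fun x => \sum_(i <- s) f i x)) /\
  \int[mu]_(x in D) (\sum_(i <- s) f i x) = \sum_(i <- s) \int[mu]_(x in D) f i x.
Proof.
move=> fi; elim: s => [|i s [IH1 IH2]].
  have E : (fun x : 'rV[R]_d => \sum_(i <- [::]) f i x) = cst 0.
    by apply/funext => x; rewrite big_nil.
  by rewrite E big_nil Rintegral_cst// mul0r; split => //; exact: integrable0.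
have E : (fun x : 'rV[R]_d => \sum_(i <- i :: s) f i x) = (fun x => f i x + \sum_(i <- s) f i x).
  by apply/funext => x; rewrite big_cons.
rewrite E big_cons -IH2 RintegralD//; split => //.
by have := integrableD mD (fi i) IH1; apply: eq_integrable.
Qed.

Lemma L2_dotE u v : L2_field D u -> L2_field D v ->
  L2_dot D u v = \sum_i dot D (coord i u) (coord i v).
Proof.
move=> uL vL; apply: (proj2 (@Rintegral_sum _ (fun i x => u x ord0 i * v x ord0 i) _)) => i.
exact: (L2_mul_integrable mD (uL i) (vL i)).
Qed.

Lemma L2_dotC u v : L2_dot D u v = L2_dot D v u.
Proof. by apply: eq_Rintegral => x _; apply: eq_bigr => i _; rewrite mulrC. Qed.

Lemma semi_inner_L2_dot : semi_inner (L2_field D) (L2_dot D).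
Proof.
have [_ LD LZ] := subspace_L2 mD.
apply: semi_innerP; [exact: subspace_L2_field|exact: L2_dotC| |].
- move=> a u v w uL vL wL; case: subspace_L2_field => _ VD VZ.
  have auvL : L2_field D (a *: u + v) by apply: VD => //; exact: VZ.
  rewrite !L2_dotE// mulr_sumr -big_split; apply: eq_bigr => i _ /=.
  have [uiL viL wiL] := And3 (uL i) (vL i) (wL i); have auiL := LZ a _ uiL.
  by rewrite coord_scaleD (siDl siD) ?(siZl siD).
- by move=> u uL; rewrite L2_dotE//; apply: sumr_ge0 => i _; exact: si_ge0 siD _ (uL i).
Qed.

Lemma seminorm_coord i u : L2_field D u ->
  seminorm (dot D) (coord i u) <= seminorm (L2_dot D) u.
Proof.
move=> uL; rewrite ler_wsqrtr// L2_dotE// (bigD1 i)//= lerDl.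
by apply: sumr_ge0 => k _; exact: si_ge0 siD _ (uL k).
Qed.

Lemma cvg_seminorm_coord (u_ : nat -> vector_field) u :
  (forall k, L2_field D (u_ k)) -> L2_field D u ->
  (forall i, seminorm (dot D) ((coord i (u_ k) : scalar_field) - coord i u) @[k --> \oo] --> (0 : R)) ->
  seminorm (L2_dot D) (u_ k - u) @[k --> \oo] --> (0 : R).
Proof.
move=> u_L uL cu; rewrite -[X in _ --> X]sqrtr0.
apply: (@continuous_cvg _ _ _ _ _ (fun k => L2_dot D (u_ k - u) (u_ k - u)) (@Num.sqrt R)).
  exact: sqrt_continuous.
have dL k : L2_field D (u_ k - u) by exact: (subspaceB subspace_L2_field).
rewrite (_ : (fun k => _) = (fun k => \sum_i seminorm (dot D) ((coord i (u_ k) : scalar_field) - coord i u) ^+ 2)); last first.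
  apply/funext => k; rewrite L2_dotE//; apply: eq_bigr => i _.
  by rewrite -coordB (sqr_seminorm siD)//; exact: dL.
rewrite -[X in _ --> X](_ : \sum_(i < d) (0 : R) ^+ 2 = 0); last by rewrite big1// => i _; rewrite expr0n.
by apply: cvg_sum_ord => i; rewrite !expr2; apply: cvgM; exact: cu.
Qed.

Lemma L2_field_fast_complete : fast_complete (L2_dot D) (L2_field D).
Proof.
move=> u_ u_L u_C.
have Hex i : exists p : scalar_field, L2 D p /\
    seminorm (dot D) ((coord i (u_ k) : scalar_field) - p) @[k --> \oo] --> (0 : R).
  have Ci k : seminorm (dot D) ((coord i (u_ k.+1) : scalar_field) - coord i (u_ k)) <= 2^-1 ^+ k.
    rewrite -coordB; apply: le_trans (u_C k); apply: seminorm_coord.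
    exact: (subspaceB subspace_L2_field).
  have [p pL pc] := L2_fast_complete mD Doo (fun k => u_L k i) Ci.
  by exists p.
have [p_ Hp] := choice Hex.
pose u x := \row_i p_ i x.
have uE i : coord i u = p_ i by apply/funext => x; rewrite /coord mxE.
have uL : L2_field D u by move=> i; rewrite uE; exact: (Hp i).1.
exists u => //; apply: cvg_seminorm_coord => // i; rewrite uE; exact: (Hp i).2.
Qed.

Lemma ae_eq_L2_dot u u' v : L2_field D u -> L2_field D u' -> L2_field D v ->
  (forall i, {ae mu, forall x, D x -> u x ord0 i = u' x ord0 i}) ->
  L2_dot D u v = L2_dot D u' v.
Proof.
move=> uL uL' vL uu'; rewrite !L2_dotE//; apply: eq_bigr => i _.
exact: (ae_eq_dot mD (uL i) (uL' i) (vL i) (uu' i)).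
Qed.

End L2_vector.

Section sobolev.
Variable Omega : set 'rV[R]_d.
Hypotheses (oO : open Omega) (Ooo : (mu Omega < +oo)%E).
Let mO : measurable Omega. Proof. exact: open_measurable_rV. Qed.
Let siO := semi_inner_L2_dot mO.
Let sL2 := subspace_L2_field mO.
Local Notation wpf := (weak_partial_field Omega).

Lemma coord_weak_partial_field i j u : coord i (wpf j u) = weak_partial Omega j (coord i u).
Proof. by apply/funext => x; rewrite /coord mxE. Qed.

Lemma H1_weak_partial u : H1 Omega u -> forall j, L2_field Omega (wpf j u) /\
  forall i, is_weak_partial Omega j (coord i u) (coord i (wpf j u)).
Proof.
move=> [_ H] j; have P i := weak_partialP (H i j).
by split => i; rewrite coord_weak_partial_field; case: (P i).
Qed.

Lemma H1_L2 u : H1 Omega u -> L2_field Omega u. Proof. by case. Qed.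

Lemma H1_wpf_L2 j u : H1 Omega u -> L2_field Omega (wpf j u).
Proof. by move=> /H1_weak_partial/(_ j)[]. Qed.

Lemma weak_partial_field_ae u j (g : vector_field) : H1 Omega u -> L2_field Omega g ->
  (forall i, is_weak_partial Omega j (coord i u) (coord i g)) ->
  forall i, {ae mu, forall x, Omega x -> wpf j u x ord0 i = g x ord0 i}.
Proof.
move=> uH gL ug i; have [wL wp] := H1_weak_partial uH j.
exact: (is_weak_partial_unique oO Ooo (wL i) (gL i) (wp i) (ug i)).
Qed.

Lemma wpf_dot u j g v : H1 Omega u -> L2_field Omega g -> L2_field Omega v ->
  (forall i, is_weak_partial Omega j (coord i u) (coord i g)) ->
  L2_dot Omega (wpf j u) v = L2_dot Omega g v.
Proof.
move=> uH gL vL ug; apply: ae_eq_L2_dot => //; first exact: H1_wpf_L2.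
exact: weak_partial_field_ae.
Qed.

Lemma H1I u (g : 'I_d -> vector_field) : L2_field Omega u -> (forall j, L2_field Omega (g j)) ->
  (forall i j, is_weak_partial Omega j (coord i u) (coord i (g j))) -> H1 Omega u.
Proof. by move=> uL gL ug; split => // i j; exists (coord i (g j)); split => //; exact: gL. Qed.

Lemma is_weak_partial_wpf_scaleD (a : R) u v j i : H1 Omega u -> H1 Omega v ->
  is_weak_partial Omega j (coord i (a *: u + v)) (coord i (a *: wpf j u + wpf j v)).
Proof.
move=> uH vH; have [[uL u'] [vL v']] := (H1_weak_partial uH j, H1_weak_partial vH j).
rewrite !coord_scaleD; apply: is_weak_partial_scaleD;
  [by []|by []|exact: (H1_L2 uH)|exact: (H1_L2 vH)|exact: uL|exact: vL|exact: u'|exact: v'].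
Qed.

Lemma H1_scaleD (a : R) u v : H1 Omega u -> H1 Omega v -> H1 Omega (a *: u + v).
Proof.
move=> uH vH; case: sL2 => _ VD VZ; apply: (@H1I _ (fun j => a *: wpf j u + wpf j v)).
- by apply: VD; [apply: VZ|]; exact: H1_L2.
- by move=> j; apply: VD; [apply: VZ|]; exact: H1_wpf_L2.
- by move=> i j; exact: is_weak_partial_wpf_scaleD.
Qed.

Lemma wpf_dot_scaleD (a : R) u v w j : H1 Omega u -> H1 Omega v -> L2_field Omega w ->
  L2_dot Omega (wpf j (a *: u + v)) w = a * L2_dot Omega (wpf j u) w + L2_dot Omega (wpf j v) w.
Proof.
move=> uH vH wL; case: sL2 => _ VD VZ.
have [uL vL] := (H1_wpf_L2 j uH, H1_wpf_L2 j vH); have auL := VZ a _ uL.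
rewrite (@wpf_dot _ _ (a *: wpf j u + wpf j v))//.
- by rewrite (siDl siO)// (siZl siO).
- exact: H1_scaleD.
- exact: VD.
- by move=> i; exact: is_weak_partial_wpf_scaleD.
Qed.

Lemma H1_0 : H1 Omega (0 : vector_field).
Proof.
have L0 : L2_field Omega (0 : vector_field) by case: sL2.
apply: (@H1I _ (fun=> 0)) => // i j phi _; rewrite coord_zero -[LHS]/(dot Omega 0 _) -[X in - X]/(dot Omega 0 _).
rewrite /dot; under eq_Rintegral do rewrite mul0r; rewrite Rintegral_cst// mul0r.
by under eq_Rintegral do rewrite mul0r; rewrite Rintegral_cst// mul0r oppr0.
Qed.

Lemma subspace_H1 : subspace (H1 Omega).
Proof.
split; first exact: H1_0.
- by move=> u v uH vH; rewrite -[u]scale1r; exact: H1_scaleD.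
- by move=> a u uH; rewrite -[_ *: u]addr0; apply: H1_scaleD => //; exact: H1_0.
Qed.

Definition H1_dot u v : R := L2_dot Omega u v + stokes_form Omega u v.

Lemma stokes_formC u v : stokes_form Omega u v = stokes_form Omega v u.
Proof. by apply: eq_bigr => j _; rewrite L2_dotC. Qed.

Lemma semi_inner_H1_dot : semi_inner (H1 Omega) H1_dot.
Proof.
apply: semi_innerP; first exact: subspace_H1.
- by move=> u v; rewrite /H1_dot L2_dotC stokes_formC.
- move=> a u v w uH vH wH; have [uL vL wL] := And3 (H1_L2 uH) (H1_L2 vH) (H1_L2 wH).
  have auL : L2_field Omega (a *: u) by case: sL2 => _ _; exact.
  have S : stokes_form Omega (a *: u + v) w = a * stokes_form Omega u w + stokes_form Omega v w.
    rewrite /stokes_form mulr_sumr -big_split; apply: eq_bigr => j _ /=.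
    exact: (wpf_dot_scaleD a j uH vH (H1_wpf_L2 j wH)).
  by rewrite /H1_dot S (siDl siO auL vL wL) (siZl siO a uL wL) mulrDr addrACA.
- move=> u uH; rewrite addr_ge0//; first exact: si_ge0 siO _ (H1_L2 uH).
  by apply: sumr_ge0 => j _; exact: si_ge0 siO _ (H1_wpf_L2 j uH).
Qed.

Let siH := semi_inner_H1_dot.

Lemma L2_seminorm_le u : H1 Omega u -> seminorm (L2_dot Omega) u <= seminorm H1_dot u.
Proof.
move=> uH; rewrite ler_wsqrtr// lerDl.
by apply: sumr_ge0 => j _; exact: si_ge0 siO _ (H1_wpf_L2 j uH).
Qed.

Lemma wpf_seminorm_le j u : H1 Omega u -> seminorm (L2_dot Omega) (wpf j u) <= seminorm H1_dot u.
Proof.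
move=> uH; rewrite ler_wsqrtr// /H1_dot /stokes_form (bigD1 j)//= addrCA lerDl addr_ge0//.
  exact: si_ge0 siO _ (H1_L2 uH).
by apply: sumr_ge0 => k _; exact: si_ge0 siO _ (H1_wpf_L2 k uH).
Qed.

Lemma H1B u v : H1 Omega u -> H1 Omega v -> H1 Omega (u - v).
Proof. exact: (subspaceB subspace_H1). Qed.

Lemma seminorm_wpfB j u (g : vector_field) v : H1 Omega u -> H1 Omega v -> L2_field Omega g ->
  (forall i, is_weak_partial Omega j (coord i v) (coord i g)) ->
  seminorm (L2_dot Omega) (wpf j (u - v)) = seminorm (L2_dot Omega) (wpf j u - g).
Proof.
move=> uH vH gL vg; have uL := H1_wpf_L2 j uH.
have ugL : L2_field Omega (wpf j u - g) by exact: (subspaceB sL2).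
have wp i : is_weak_partial Omega j (coord i (u - v)) (coord i (wpf j u - g)).
  have -> : u - v = (-1) *: v + u by rewrite scaleN1r addrC.
  have -> : wpf j u - g = (-1) *: g + wpf j u by rewrite scaleN1r addrC.
  have [_ u'] := H1_weak_partial uH j.
  rewrite !coord_scaleD; apply: is_weak_partial_scaleD;
    [by []|by []|exact: (H1_L2 vH)|exact: (H1_L2 uH)|exact: gL|exact: uL|exact: vg|exact: u'].
have uvH := H1B uH vH; have uvL := H1_wpf_L2 j uvH.
congr Num.sqrt; rewrite (wpf_dot uvH ugL uvL wp) L2_dotC.
exact: (wpf_dot uvH ugL ugL wp).
Qed.

Lemma H1_fast_complete : fast_complete H1_dot (H1 Omega).
Proof.
move=> u_ u_H u_C; have u_L k := H1_L2 (u_H k).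
have CL k : seminorm (L2_dot Omega) (u_ k.+1 - u_ k) <= 2^-1 ^+ k.
  by apply: le_trans (u_C k); apply: L2_seminorm_le; exact: H1B.
have [u uL u_u] := L2_field_fast_complete mO Ooo u_L CL.
have wL j k := H1_wpf_L2 j (u_H k).
have Hex j : exists g, L2_field Omega g /\
    seminorm (L2_dot Omega) (wpf j (u_ k) - g) @[k --> \oo] --> (0 : R).
  have Cj k : seminorm (L2_dot Omega) (wpf j (u_ k.+1) - wpf j (u_ k)) <= 2^-1 ^+ k.
    have [_ wk] := H1_weak_partial (u_H k) j.
    apply: le_trans (u_C k); rewrite -(seminorm_wpfB (u_H k.+1) (u_H k) (wL j k) wk).
    by apply: wpf_seminorm_le; exact: H1B.
  have [g gL gc] := L2_field_fast_complete mO Ooo (wL j) Cj.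
  by exists g.
have [g Hg] := choice Hex.
have gL j : L2_field Omega (g j) by exact: (Hg j).1.
have coordc (f_ : nat -> vector_field) f i : (forall k, L2_field Omega (f_ k)) -> L2_field Omega f ->
    seminorm (L2_dot Omega) (f_ k - f) @[k --> \oo] --> (0 : R) ->
    seminorm (dot Omega) ((coord i (f_ k) : scalar_field) - coord i f) @[k --> \oo] --> (0 : R).
  move=> f_L fL fc; apply: (@squeeze_cvgr _ _ _ _ (cst 0) (fun k => seminorm (L2_dot Omega) (f_ k - f))) => //.
    apply: nearW => k; rewrite seminorm_ge0 -coordB seminorm_coord//.
    exact: (subspaceB sL2).
  exact: cvg_cst.
have wp i j : is_weak_partial Omega j (coord i u) (coord i (g j)).
  apply: (@is_weak_partial_closed _ _ _ oO Ooo j (fun k => coord i (u_ k)) (fun k => coord i (wpf j (u_ k)))).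
  - by move=> k; exact: u_L.
  - by move=> k; exact: wL.
  - exact: uL.
  - exact: gL.
  - by move=> k; have [_ ] := H1_weak_partial (u_H k) j; exact.
  - exact: coordc.
  - exact: (coordc _ _ _ (wL j) (gL j) (Hg j).2).
have uH : H1 Omega u by exact: (H1I uL gL).
exists u => //.
rewrite -[X in _ --> X]sqrtr0.
apply: (@continuous_cvg _ _ _ _ _ (fun k => H1_dot (u_ k - u) (u_ k - u)) (@Num.sqrt R)).
  exact: sqrt_continuous.
have E k : H1_dot (u_ k - u) (u_ k - u) = seminorm (L2_dot Omega) (u_ k - u) ^+ 2 +
    \sum_j seminorm (L2_dot Omega) (wpf j (u_ k) - g j) ^+ 2.
  have H := H1B (u_H k) uH; congr (_ + _); first by rewrite (sqr_seminorm siO)//; exact: H1_L2.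
  apply: eq_bigr => j _; rewrite -(@seminorm_wpfB _ _ (g j) u)// (sqr_seminorm siO)//.
  exact: H1_wpf_L2.
rewrite (funext E) -[X in _ --> X](_ : (0 : R) ^+ 2 + \sum_(i < d) (0 : R) ^+ 2 = 0); last first.
  by rewrite big1 ?expr0n ?addr0// => i _; rewrite expr0n.
apply: cvgD; first by rewrite !expr2; exact: cvgM.
by apply: cvg_sum_ord => j; rewrite !expr2; apply: cvgM; exact: (Hg j).2.
Qed.

End sobolev.
End vector_fields.

(** * The Stokes resolvent on one domain *)

Section stokes.
Context {R : realType} {d : nat}.
Local Notation mu := (@lebesgue_rV R d).
Local Notation vector_field := ('rV[R]_d -> 'rV[R]_d).
Local Notation scalar_field := ('rV[R]_d -> R^o).
Local Notation wpf := weak_partial_field.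
Implicit Types (u v w f G : vector_field) (i j : 'I_d).

Definition partial_field j u : vector_field := fun x => \row_i partial j (coord i u) x.

Lemma coord_partial_field i j u : coord i (partial_field j u) = partial j (coord i u).
Proof. by apply/funext => x; rewrite /coord mxE. Qed.

Section one_domain.
Variable Omega : set 'rV[R]_d.
Hypotheses (oO : open Omega) (Ooo : (mu Omega < +oo)%E).
Let mO : measurable Omega. Proof. exact: open_measurable_rV. Qed.
Let siO := semi_inner_L2_dot mO.
Let siH := semi_inner_H1_dot oO Ooo.
Let sL2 := subspace_L2_field mO.
Let sH1 := subspace_H1 oO Ooo.
Local Notation nL2 := (seminorm (L2_dot Omega)).

Lemma test_field_L2 (Omega' : set 'rV[R]_d) u : test_field Omega' u -> L2_field Omega u.
Proof. by move=> tu i; exact: test_fun_L2 (tu i). Qed.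

Lemma partial_field_L2 (Omega' : set 'rV[R]_d) j u : test_field Omega' u -> L2_field Omega (partial_field j u).
Proof. by move=> tu i; rewrite coord_partial_field; exact: test_fun_partial_L2 (tu i). Qed.

Lemma test_field_H1 u : test_field Omega u -> H1 Omega u.
Proof.
move=> tu; apply: (H1I (test_field_L2 tu) (fun j => partial_field_L2 j tu)) => i j.
by rewrite coord_partial_field; exact: test_fun_weak_partial (tu i).
Qed.

Lemma subspace_Dspace : subspace (Dspace Omega).
Proof.
have [T0 TD TZ] := subspace_coord (subspace_test_fun Omega).
have scaleD (a : R) u v : Dspace Omega u -> Dspace Omega v -> Dspace Omega (a *: u + v).
  move=> [tu du] [tv dv]; split; first by apply: TD => //; exact: TZ.
  move=> x Ox; transitivity (a * (\sum_i partial i (coord i u) x) + \sum_i partial i (coord i v) x).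
    2: by rewrite du// dv// mulr0 addr0.
  rewrite mulr_sumr -big_split; apply: eq_bigr => i _ /=.
  have -> : coord i (a *: u + v) = a *: (coord i u : scalar_field) + coord i v by exact: coord_scaleD.
  have [ei fi] := (test_fun_is_derive i x (tu i), test_fun_is_derive i x (tv i)).
  have dai : derivable (a *: (coord i u : scalar_field)) x (delta_mx ord0 i).
    by apply: derivableZ; case: ei.
  by rewrite /partial (deriveD dai (@ex_derive _ _ _ _ _ _ _ fi)) (deriveZ _ (@ex_derive _ _ _ _ _ _ _ ei)).
have D0 : Dspace Omega (0 : vector_field).
  split=> // x _; apply: big1 => i _.
  have -> : coord i (0 : vector_field) = cst (0 : R^o) by exact: coord_zero.
  by rewrite /partial derive_cst.
split=> // [u v Du Dv|a u Du]; first by rewrite -[u]scale1r; exact: scaleD.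
by rewrite -[_ *: u]addr0; exact: scaleD.
Qed.

Lemma Dspace_H1 : Dspace Omega `<=` H1 Omega.
Proof. by move=> u [tu _]; exact: test_field_H1. Qed.

Lemma VspaceE : Vspace Omega = semi_closure (H1 Omega) (H1_dot Omega) (Dspace Omega).
Proof.
apply/seteqP; split => [u []//|u uV]; split => //.
by case: uV => uH uD; split => // e /uD[v [tv _] uv]; exists v.
Qed.

Lemma Vspace_H1 : Vspace Omega `<=` H1 Omega.
Proof. by rewrite VspaceE => u []. Qed.

Lemma Dspace_Vspace : Dspace Omega `<=` Vspace Omega.
Proof. by rewrite VspaceE; apply: subset_semi_closure => //; exact: Dspace_H1. Qed.

Lemma subspace_Vspace : subspace (Vspace Omega).
Proof. by rewrite VspaceE; apply: subspace_semi_closure => //; [exact: Dspace_H1|exact: subspace_Dspace]. Qed.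

Lemma Vspace_fast_complete : fast_complete (H1_dot Omega) (Vspace Omega).
Proof.
rewrite VspaceE; apply: fast_complete_semi_closure => //; first exact: Dspace_H1.
exact: H1_fast_complete.
Qed.

Lemma L2_loc_mul_integrable (p phi g : scalar_field) : L2_loc Omega p -> test_fun Omega phi ->
  L2 (supp phi) g -> (forall x, ~ supp phi x -> g x = 0) ->
  mu.-integrable Omega (EFin \o (fun x => p x * g x)).
Proof.
move=> pL [sp cp pO] gL g0; have mK : measurable (supp phi).
  by apply: closed_measurable_rV; exact: closed_closure.
have : mu.-integrable setT (EFin \o (fun x => p x * g x)).
  apply/(integrable_setTP mK); first by move=> x /g0 ->; rewrite mulr0.
  by apply: L2_mul_integrable => //; exact: pL.
exact: integrableS.
Qed.

Lemma Dspace_gradient v G : Dspace Omega v -> gradients Omega G -> L2_dot Omega v G = 0.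
Proof.
move=> [tv dv] [GL [p [pL pG]]].
rewrite L2_dotE//; last exact: test_field_L2 tv.
have E i : dot Omega (coord i v) (coord i G) = - \int[mu]_(x in Omega) (p x * partial i (coord i v) x).
  by rewrite (pG i _ (tv i)) opprK dotC.
under eq_bigr do rewrite E.
rewrite sumrN; apply/eqP; rewrite oppr_eq0; apply/eqP.
have ip i : mu.-integrable Omega (EFin \o (fun x => p x * partial i (coord i v) x)).
  have [_ cK _] := tv i.
  apply: (L2_loc_mul_integrable pL (tv i)); last by move=> x; exact: notin_supp_partial.
  apply: test_fun_partial_L2 (tv i).
    by apply: closed_measurable_rV; exact: closed_closure.
  apply: lebesgue_bounded_lty; first by apply: closed_measurable_rV; exact: closed_closure.
  exact: (@compact_bounded R 'rV[R]_d).
have [_ <-] := @Rintegral_sum _ _ _ mO (index_enum 'I_d) _ ip.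
rewrite (@eq_Rintegral _ _ _ _ _ (cst 0)) ?Rintegral_cst ?mul0r// => x /set_mem Ox.
by rewrite -mulr_sumr dv// mulr0.
Qed.

Lemma Vspace_Hspace : Vspace Omega `<=` Hspace Omega.
Proof.
move=> u uV; have uH := Vspace_H1 uV; split; first exact: H1_L2.
move=> G gG; have GL : L2_field Omega G by case: gG.
move: u uV {uH}; rewrite VspaceE.
apply: (semi_closure_eq0 (C := nL2 G) Dspace_H1).
  move=> u v uH vD; have vH := Dspace_H1 vD; have [uL vL] := (H1_L2 uH, H1_L2 vH).
  have uvL : L2_field Omega (u - v) by exact: (subspaceB sL2).
  rewrite -(siBl siO uL vL GL); apply: le_trans (CauchySchwarz siO uvL GL) _.
  rewrite mulrC ler_wpM2l ?seminorm_ge0//; apply: L2_seminorm_le => //.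
  exact: (subspaceB sH1).
by move=> v vD; exact: Dspace_gradient.
Qed.

Lemma Hspace_L2 u : Hspace Omega u -> L2_field Omega u. Proof. by case. Qed.

Lemma subspace_Hspace : subspace (Hspace Omega).
Proof.
case: (sL2) => L0 LD LZ; split.
- split=> // G [GL _]; have := siZl siO 0 L0 GL; by rewrite scaler0 mul0r.
- move=> u v [uL uG] [vL vG]; split; first exact: LD.
  by move=> G gG; case: (gG) => GL _; rewrite (siDl siO uL vL GL) uG// vG// addr0.
- move=> a u [uL uG]; split; first exact: LZ.
  by move=> G gG; case: (gG) => GL _; rewrite (siZl siO a uL GL) uG// mulr0.
Qed.

Lemma Hspace_fast_complete : fast_complete (L2_dot Omega) (Hspace Omega).
Proof.
move=> u_ u_H u_C; have u_L k := Hspace_L2 (u_H k).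
have [u uL uc] := L2_field_fast_complete mO Ooo u_L u_C.
exists u => //; split=> // G gG; have GL : L2_field Omega G by case: gG.
have := cvg_semi_inner siO u_L uL GL uc.
rewrite (_ : (fun k => _) = cst 0); last by apply/funext => k; case: (u_H k) => _ ->.
by move=> H; apply: (cvg_unique _ H (@cvg_cst _ _ _ _ _)).
Qed.

Lemma lerayP f : L2_field Omega f -> Hspace Omega (leray Omega f) /\
  forall h, Hspace Omega h -> L2_dot Omega (leray Omega f) h = L2_dot Omega f h.
Proof.
move=> fL.
have [|||g gH gf] := @Riesz_representation _ _ _ _ siO (Hspace Omega) (L2_dot Omega f) (nL2 f)
  subspace_Hspace (fun u => @Hspace_L2 u) Hspace_fast_complete.
- by move=> x y xH yH; exact: (siDr siO (Hspace_L2 xH) (Hspace_L2 yH) fL).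
- by move=> a x xH; exact: (siZr siO a (Hspace_L2 xH) fL).
- by move=> x xH; exact: (CauchySchwarz siO fL (Hspace_L2 xH)).
have [] : Hspace Omega (leray Omega f) /\
    forall h, Hspace Omega h -> L2_dot Omega (f \- leray Omega f) h = 0.
  apply: (@getPex _ [set g | Hspace Omega g /\
    forall h, Hspace Omega h -> L2_dot Omega (f \- g) h = 0]).
  exists g; split => // h hH.
  have := siBl siO fL (Hspace_L2 gH) (Hspace_L2 hH); rewrite gf// subrr; exact.
move=> H1 H2.
split=> // h hH; apply/esym/eqP; rewrite -subr_eq0; apply/eqP.
by rewrite -(siBl siO fL (Hspace_L2 H1) (Hspace_L2 hH)); exact: H2.
Qed.

Lemma stokes_resolventP f : Hspace Omega f -> Vspace Omega (stokes_resolvent Omega f) /\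
  forall v, Vspace Omega v -> H1_dot Omega (stokes_resolvent Omega f) v = L2_dot Omega f v.
Proof.
move=> fH; have fL := Hspace_L2 fH.
have VL v : Vspace Omega v -> L2_field Omega v by move=> /Vspace_H1/H1_L2.
have [|||u uV uf] := @Riesz_representation _ _ _ _ siH (Vspace Omega) (L2_dot Omega f) (nL2 f)
  subspace_Vspace Vspace_H1 Vspace_fast_complete.
- by move=> x y xV yV; exact: (siDr siO (VL _ xV) (VL _ yV) fL).
- by move=> a x xV; exact: (siZr siO a (VL _ xV) fL).
- move=> x xV; apply: le_trans (CauchySchwarz siO fL (VL _ xV)) _.
  by rewrite ler_wpM2l ?seminorm_ge0//; apply: L2_seminorm_le => //; exact: Vspace_H1.
have [w [[rV wH rw] fE]] : exists w, stokes Omega (stokes_resolvent Omega f) w /\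
    {ae mu, forall x, Omega x -> stokes_resolvent Omega f x + w x = f x}.
  apply: (@getPex _ [set u | exists w, stokes Omega u w /\
    {ae mu, forall x, Omega x -> u x + w x = f x}]).
  exists u, (f - u); split; last first.
    by apply: aeW => x _; rewrite -[(f - u) x]/(f x - u x) addrC subrK.
  split => //.
    by apply: (subspaceB subspace_Hspace) => //; exact: Vspace_Hspace.
  move=> v vV; rewrite (siBl siO fL (VL _ uV) (VL _ vV)) -(uf v vV) /H1_dot.
  by rewrite addrAC subrr add0r.
split=> [|v vV]; first exact: rV.
rewrite /H1_dot (rw v vV).
have [rL wL vL] := And3 (VL _ rV) (Hspace_L2 wH) (VL _ vV).
rewrite -(siDl siO rL wL vL); apply: (ae_eq_L2_dot mO) => //.
  by case: sL2 => _ + _; apply.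
by move=> i; apply: filterS fE => x H Ox; rewrite -(H Ox).
Qed.

End one_domain.
End stokes.

(** * Extension by zero *)

Section extension.
Context {R : realType} {d : nat}.
Local Notation mu := (@lebesgue_rV R d).
Local Notation vector_field := ('rV[R]_d -> 'rV[R]_d).
Local Notation scalar_field := ('rV[R]_d -> R^o).
Local Notation wpf := weak_partial_field.
Implicit Types (u v w f : vector_field) (i j : 'I_d).

Variables (Omega' Omega : set 'rV[R]_d).
Hypotheses (oO' : open Omega') (oO : open Omega) (OO' : Omega' `<=` Omega).
Hypothesis (Ooo : (mu Omega < +oo)%E).
Let mO' : measurable Omega'. Proof. exact: open_measurable_rV. Qed.
Let mO : measurable Omega. Proof. exact: open_measurable_rV. Qed.

Let Ooo' : (mu Omega' < +oo)%E.
Proof. by apply: le_lt_trans Ooo; apply: le_measure => //; rewrite inE. Qed.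

Let siO := semi_inner_L2_dot mO.
Let siH := semi_inner_H1_dot oO Ooo.
Let sV := subspace_Vspace oO' Ooo'.
Local Notation E := (ext0 Omega').

Lemma ext0_in u x : Omega' x -> E u x = u x.
Proof. by move=> xO; rewrite /ext0 /patch mem_set. Qed.

Lemma ext0_out u x : ~ Omega' x -> E u x = 0.
Proof. by move=> xO; rewrite /ext0 /patch memNset. Qed.

Lemma ext0B u v : E (u - v) = E u - E v.
Proof.
apply/funext => x; rewrite -[RHS]/(E u x - E v x).
by have [xO|xO] := pselect (Omega' x); [rewrite !ext0_in|rewrite !ext0_out// subrr].
Qed.

Lemma ext0_id u : (forall x, ~ Omega' x -> u x = 0) -> E u = u.
Proof.
move=> u0; apply/funext => x.
by have [xO|xO] := pselect (Omega' x); [rewrite ext0_in|rewrite ext0_out// u0].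
Qed.

Lemma Rintegral_subset (F G : 'rV[R]_d -> R) : (forall x, Omega' x -> F x = G x) ->
  (forall x, ~ Omega' x -> F x = 0) ->
  \int[mu]_(x in Omega) F x = \int[mu]_(x in Omega') G x.
Proof.
move=> FG F0; transitivity (\int[mu]_(x in Omega') F x).
  by rewrite !Rintegral_setT// => x xO; apply: F0 => /OO'.
by apply: eq_Rintegral => x /set_mem; exact: FG.
Qed.

Lemma L2_dot_ext0 u v w : (forall x, Omega' x -> v x = w x) ->
  L2_dot Omega (E u) v = L2_dot Omega' u w.
Proof.
move=> vw; apply: Rintegral_subset => x xO.
  by apply: eq_bigr => i _; rewrite ext0_in// vw.
by apply: big1 => i _; rewrite ext0_out// mxE mul0r.
Qed.

Lemma L2_subset (p : scalar_field) : L2 Omega p -> L2 Omega' p.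
Proof.
move=> [mp ip]; split; first exact: measurable_funS mp.
exact: integrableS ip.
Qed.

Lemma L2_field_subset u : L2_field Omega u -> L2_field Omega' u.
Proof. by move=> uL i; exact: L2_subset. Qed.

Lemma L2_field_ext0 u : L2_field Omega' u -> L2_field Omega (E u).
Proof.
move=> uL i; have [mu' iu] := uL i.
have cE : coord i (E u) = (coord i u) \_ Omega'.
  by apply/funext => x; rewrite patchE /coord /ext0 /patch; case: ifP => // _; rewrite mxE.
rewrite cE; split.
  by apply: measurable_funTS; apply/(measurable_restrictT _ mO').
apply: (@integrableS _ _ _ _ setT) => //.
apply/(integrable_setTP mO').
  by move=> x xO; rewrite patchE memNset// expr0n.
apply: eq_integrable iu => // x xO.
by rewrite /= patchE xO.
Qed.

Lemma Vspace_weak_partial_test u i j phi : Vspace Omega' u -> test_fun Omega phi ->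
  dot Omega' (coord i u) (partial j phi) + dot Omega' (coord i (wpf Omega' j u)) phi = 0.
Proof.
move=> uV tphi.
have pL : L2 Omega' (phi : scalar_field) by exact: test_fun_L2 tphi.
have dpL : L2 Omega' (partial j phi : scalar_field) by exact: test_fun_partial_L2 tphi.
pose C := seminorm (dot Omega') (partial j phi) + seminorm (dot Omega') phi.
have sid := semi_inner_dot mO'.
move: uV; rewrite VspaceE.
apply: (semi_closure_eq0 (S := Dspace Omega') (L := H1 Omega') (B := H1_dot Omega')
  (l := fun u => dot Omega' (coord i u) (partial j phi) + dot Omega' (coord i (wpf Omega' j u)) phi) (C := C)).
- exact: Dspace_H1.
- move=> {}u v uH vD; have vH := Dspace_H1 oO' Ooo' vD.
  have uvH := H1B oO' Ooo' uH vH.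
  have [wuL wvL] := (H1_wpf_L2 j uH, H1_wpf_L2 j vH).
  have wuvL : L2_field Omega' (wpf Omega' j u - wpf Omega' j v) by exact: (subspaceB (subspace_L2_field mO')).
  have uvL := H1_L2 uvH.
  have [_ wv] := H1_weak_partial vH j.
  have -> : dot Omega' (coord i u) (partial j phi) + dot Omega' (coord i (wpf Omega' j u)) phi -
     (dot Omega' (coord i v) (partial j phi) + dot Omega' (coord i (wpf Omega' j v)) phi) =
     dot Omega' (coord i (u - v)) (partial j phi) + dot Omega' (coord i (wpf Omega' j u - wpf Omega' j v)) phi.
    rewrite !coordB (siBl sid (H1_L2 uH i) (H1_L2 vH i) dpL) (siBl sid (wuL i) (wvL i) pL).
    by rewrite opprD addrACA.
  apply: le_trans (ler_normD _ _) _; rewrite /C mulrDl; apply: lerD.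
    apply: le_trans (CauchySchwarz sid (uvL i) dpL) _; rewrite mulrC ler_wpM2l ?seminorm_ge0//.
    exact: le_trans (seminorm_coord mO' i uvL) (L2_seminorm_le oO' uvH).
  apply: le_trans (CauchySchwarz sid (wuvL i) pL) _; rewrite mulrC ler_wpM2l ?seminorm_ge0//.
  apply: le_trans (seminorm_coord mO' i wuvL) _.
  by rewrite -(seminorm_wpfB oO' Ooo' uH vH wvL wv); exact: wpf_seminorm_le.
- move=> v [tv _]; have vH := test_field_H1 oO' Ooo' tv.
  have ctp := partial_mul_integral j (tv i) tphi.
  have vL : L2 Omega' (coord i v : scalar_field) by exact: test_fun_L2 (tv i).
  have dvL : L2 Omega' (partial j (coord i v) : scalar_field) by exact: test_fun_partial_L2 (tv i).
  have -> : dot Omega' (coord i (wpf Omega' j v)) phi = dot Omega' (partial j (coord i v)) phi.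
    have [wL wp] := H1_weak_partial vH j.
    apply: (ae_eq_dot mO' (wL i) dvL pL).
    apply: (is_weak_partial_unique oO' Ooo' (wL i) dvL (wp i)).
    exact: test_fun_weak_partial (tv i).
  rewrite /dot -RintegralD//; [|exact: (L2_mul_integrable mO' vL dpL)|exact: (L2_mul_integrable mO' dvL pL)].
  rewrite Rintegral_setT; last first.
    by move=> x xO; rewrite (test_fun_notin (tv i) xO) (test_fun_partial_notin j (tv i) xO) !mul0r addr0.
  by rewrite -ctp; apply: eq_Rintegral => x _; rewrite (mulrC (phi x)).
Qed.

Lemma ext0_weak_partial u i j : Vspace Omega' u ->
  is_weak_partial Omega j (coord i (E u)) (coord i (E (wpf Omega' j u))).
Proof.
move=> uV phi tphi; apply/eqP; rewrite -subr_eq0 opprK; apply/eqP.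
rewrite -(Vspace_weak_partial_test i j uV tphi); congr (_ + _); apply: Rintegral_subset => x xO.
- by rewrite /coord ext0_in.
- by rewrite /coord ext0_out// mxE mul0r.
- by rewrite /coord ext0_in.
- by rewrite /coord ext0_out// mxE mul0r.
Qed.

Lemma H1_ext0 u : Vspace Omega' u -> H1 Omega (E u).
Proof.
move=> uV; have uH := Vspace_H1 uV.
apply: (@H1I _ _ _ _ (fun j => E (wpf Omega' j u))).
- exact/L2_field_ext0/H1_L2.
- by move=> j; apply: L2_field_ext0; exact: H1_wpf_L2.
- by move=> i j; exact: ext0_weak_partial.
Qed.

Lemma H1_dot_ext0 u v : Vspace Omega' u -> Vspace Omega' v ->
  H1_dot Omega (E u) (E v) = H1_dot Omega' u v.
Proof.
move=> uV vV; have [uE vE] := (H1_ext0 uV, H1_ext0 vV).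
have [uH vH] := (Vspace_H1 uV, Vspace_H1 vV).
congr (_ + _); first by apply: L2_dot_ext0 => x; exact: ext0_in.
apply: eq_bigr => j _.
have [uL vL] := (L2_field_ext0 (H1_wpf_L2 j uH), L2_field_ext0 (H1_wpf_L2 j vH)).
have uw i := ext0_weak_partial i j uV; have vw i := ext0_weak_partial i j vV.
rewrite (wpf_dot oO Ooo uE uL (H1_wpf_L2 j vE) uw) L2_dotC.
rewrite (wpf_dot oO Ooo vE vL uL vw) L2_dotC.
by apply: L2_dot_ext0 => x; exact: ext0_in.
Qed.

Lemma Dspace_subset : Dspace Omega' `<=` Dspace Omega.
Proof.
move=> v [tv dv]; split; first by move=> i; exact: test_funS (tv i).
move=> x xO; have [xO'|xO'] := pselect (Omega' x); first exact: dv.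
by apply: big1 => i _; exact: test_fun_partial_notin (tv i) xO'.
Qed.

Lemma Dspace_ext0 v : Dspace Omega' v -> E v = v.
Proof.
move=> [tv _]; apply: ext0_id => x xO; apply/rowP => i.
by rewrite mxE; exact: test_fun_notin (tv i) xO.
Qed.

Lemma Vspace_ext0 u : Vspace Omega' u -> Vspace Omega (E u).
Proof.
move=> uV; rewrite VspaceE; split; first exact: H1_ext0.
move=> e e0; move: (uV); rewrite VspaceE => -[_ /(_ e e0)[v vD uv]].
exists v; first exact: Dspace_subset.
have vV := Dspace_Vspace oO' Ooo' vD.
have uvV : Vspace Omega' (u - v) by exact: (subspaceB sV).
by rewrite -{1}(Dspace_ext0 vD) -ext0B /seminorm H1_dot_ext0.
Qed.

Lemma stokes_resolvent_best_approximation f v : Hspace Omega f -> Dspace Omega' v ->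
  let u := stokes_resolvent Omega f in
  let u' := E (stokes_resolvent Omega' (leray Omega' f)) in
  L2_field Omega u' /\ seminorm (L2_dot Omega) (u' - u) <= seminorm (H1_dot Omega) (u - v).
Proof.
move=> fH vD u u'; have fL := Hspace_L2 fH.
have [lH lf] := lerayP oO' Ooo' (L2_field_subset fL).
have [rV rf] := stokes_resolventP oO' Ooo' lH.
have [uV uf] := stokes_resolventP oO Ooo fH.
have u'V : Vspace Omega u' by exact: Vspace_ext0.
have vV' := Dspace_Vspace oO' Ooo' vD.
have vV := Dspace_Vspace oO Ooo (Dspace_subset vD).
have [uH u'H vH] := And3 (Vspace_H1 uV) (Vspace_H1 u'V) (Vspace_H1 vV).
have orth w : Vspace Omega' w -> H1_dot Omega (u - u') (E w) = 0.
  move=> wV; have wE := Vspace_ext0 wV.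
  rewrite (siBl siH uH u'H (Vspace_H1 wE)) (uf _ wE) H1_dot_ext0// (rf _ wV).
  rewrite (lf _ (Vspace_Hspace oO' Ooo' wV)) (L2_dotC Omega f) (@L2_dot_ext0 w f f)//.
  by rewrite L2_dotC subrr.
have u'L := H1_L2 u'H.
split; first exact: u'L.
rewrite (seminormBC siO u'L (H1_L2 uH)).
apply: le_trans (L2_seminorm_le oO (H1B oO Ooo uH u'H)) _.
apply: (orthogonal_seminorm_le siH uH u'H vH).
rewrite -{1}(Dspace_ext0 vD) -ext0B; apply: orth; exact: (subspaceB sV).
Qed.

End extension.

(** * Convergence *)

Lemma Dspace_exhaustion {R : realType} {d : nat} (Omega : set 'rV[R]_d)
    (Omega_ : nat -> set 'rV[R]_d) v :
  domain_cvg Omega_ Omega -> Dspace Omega v -> exists N, forall n, (N <= n)%N -> Dspace (Omega_ n) v.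
Proof.
move=> [sO KO] [tv dv].
have nd m n : (m <= n)%N -> Omega_ m `<=` Omega_ n.
  elim: n => [|n IH]; first by rewrite leqn0 => /eqP ->.
  rewrite leq_eqVlt => /predU1P[->//|]; rewrite ltnS => /IH H.
  by apply: subset_trans H _; case: (sO n).
have Hex i : exists n, supp (coord i v) `<=` Omega_ n.
  by have [_ cK KOm] := tv i; exact: KO.
have [N_ HN] := choice Hex.
exists (\max_i N_ i)%N => n Nn; split.
  move=> i; have [si cK _] := tv i; split => //.
  by apply: subset_trans (HN i) (nd _ _ _); apply: leq_trans Nn; exact: leq_bigmax.
by move=> x xn; apply: dv; case: (sO n) => nS Sn; apply: Sn; exact: nS.
Qed.

Theorem theorem4p1 (R : realType) (d : nat)
    (Omega : set 'rV[R]_d) (Omega_ : nat -> set 'rV[R]_d)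
    (open_Omega : open Omega) (bounded_Omega : bounded_set Omega)
    (open_Omega_ : forall n, open (Omega_ n))
    (bounded_Omega_ : forall n, bounded_set (Omega_ n))
    (Omega_cvg : domain_cvg Omega_ Omega)
    (f : 'rV[R]_d -> 'rV[R]_d) (Hf : Hspace Omega f) :
  let u_ n := stokes_resolvent (Omega_ n) (leray (Omega_ n) f) in
  L2_cvg Omega (fun n => ext0 (Omega_ n) (u_ n)) (stokes_resolvent Omega f).
Proof.
move=> u_.
have sO n : Omega_ n `<=` Omega.
  by case: Omega_cvg => /(_ n)[nS Sn] _; exact: subset_trans Sn.
have Ooo := lebesgue_bounded_lty (open_measurable_rV open_Omega) bounded_Omega.
have [uV _] := stokes_resolventP open_Omega Ooo Hf.
have best n v := @stokes_resolvent_best_approximation _ _ (Omega_ n) Omega (open_Omega_ n)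
  open_Omega (sO n) Ooo f v Hf.
have D0 n : Dspace (Omega_ n) 0 by case: (subspace_Dspace (Omega_ n)).
split.
- by move=> n; have [] := best n 0 (D0 n).
- exact: H1_L2 (Vspace_H1 uV).
- apply/cvgr0Pnorm_lt => e e0; rewrite VspaceE in uV.
  have [_ /(_ e e0)[v vD uv]] := uV.
  have [N HN] := Dspace_exhaustion Omega_cvg vD.
  exists N => // n /= Nn; rewrite ger0_norm ?sqrtr_ge0//.
  by apply: le_lt_trans uv; have [_] := best n v (HN n Nn); exact.
Qed.
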